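(* For any finitary convergent processes $\Delta$ and $\Gamma$, if $\Delta\sqsubseteq_{FS}\Gamma$ then $\Delta\sqsubseteq_{\mathbf{rr}\mathrm{must}}\Gamma$.
   Context: Subdistributions over $S$: $\Delta:S\to[0,1]$, $\sum_s\Delta(s)\le1$, support $\lceil\Delta\rceil$, pointwise sums/scalar multiples, $\overline s$ point distribution, $\varepsilon$ zero subdistribution; $\mathrm{Exp}_\Delta(f)=\sum_s\Delta(s)f(s)$ componentwise; $f(\Delta)(t)=\sum_{f(s)=t}\Delta(s)$. A pLTS $\langle S,L,\to\rangle$ has $\to\subseteq S\times(L\cup\{\tau\})\times\mathcal D(S)$ ($\mathcal D(S)$ full distributions, $\tau\notin L$); deterministic: at most one $\Delta$ with $s\xrightarrow{\alpha}\Delta$ per $s,\alpha$; finitely branching: $\{\Delta\mid s\xrightarrow{\alpha}\Delta\}$ finite for each $s$; a subdistribution is finitary if the sub-pLTS of states reachable from it has finitely many states and is finitely branching. Processes are distributions over a fixed pLTS $\langle\mathbf P,\mathsf{Act},\to_{\mathbf P}\rangle$. A process $\Delta$ is convergent if there is no infinite sequence $\Lambda_0\xrightarrow{\tau}\Lambda_1\xrightarrow{\tau}\cdots$ (lifted transitions) with $\Lambda_0$ reachable from $\Delta$. $\Omega$ (countably infinite) is a set of success actions disjoint from $\mathsf{Act}\cup\{\tau\}$; $\Omega$-tests are distributions over a fixed pLTS $\langle\mathbf T,\mathsf{Act}\cup\Omega,\to_{\mathbf T}\rangle$ (assumed sufficiently expressive, e.g. interpreting all pCSP processes) whose states satisfy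 (A) $t\xrightarrow{\omega_1},t\xrightarrow{\omega_2}$ ($\omega_i\in\Omega$) imply $\omega_1=\omega_2$; (B) if $t\xrightarrow{\omega}$ and $t\xrightarrow{\alpha}\Delta$ ($\alpha\in\mathsf{Act}\cup\{\tau\}$) then $u\xrightarrow{\omega}$ for all $u\in\lceil\Delta\rceil$. $\Theta\|\Delta$ lives in the pLTS on $\{t\|p\}$ with labels $\Omega$ generated by: $t\xrightarrow{\alpha}_{\mathbf T}\Theta$, $\alpha\notin\mathsf{Act}$ gives $t\|p\xrightarrow{\alpha}\Theta\|\overline p$; $p\xrightarrow{\tau}_{\mathbf P}\Delta$ gives $t\|p\xrightarrow{\tau}\overline t\|\Delta$; $t\xrightarrow{a}\Theta,p\xrightarrow{a}\Delta$, $a\in\mathsf{Act}$ give $t\|p\xrightarrow{\tau}\Theta\|\Delta$; $(\Theta\|\Delta)(t\|p)=\Theta(t)\Delta(p)$. Resolutions of $\Theta\|\Delta$: $\langle R,\Lambda,\to_R\rangle$ with $\langle R,\Omega,\to_R\rangle$ deterministic, $\Lambda$ a subdistribution over $R$, and $f:R\to\mathbf C$ with $f(\Lambda)=\Theta\|\Delta$, $r\xrightarrow{\alpha}_R\Lambda''\Rightarrow f(r)\xrightarrow{\alpha}f(\Lambda'')$, $f(r)\xrightarrow{\alpha}\Rightarrow r\xrightarrow{\alpha}_R$. $\mathbb V$ is the least fixed point of $\mathcal R(f)(r)(\omega)=1$ if $r\xrightarrow{\omega}$; $0$ if $r\not\xrightarrow{\omega},r\not\xrightarrow{\tau}$; $\mathrm{Exp}_{\Delta}(f)(\omega)$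 if $r\not\xrightarrow{\omega}$, $r\xrightarrow{\tau}\Delta$. $\mathcal A(\Theta,\Delta)=\{\mathrm{Exp}_\Lambda(\mathbb V)\mid\text{resolutions of }\Theta\|\Delta\}$. $\Delta\sqsubseteq_{\mathbf{rr}\mathrm{must}}\Gamma$ iff for all $\Omega$-tests $\Theta$ and $h\in[-1,1]^\Omega$, $\inf h\cdot\mathcal A(\Theta,\Delta)\le\inf h\cdot\mathcal A(\Theta,\Gamma)$, where $h\cdot o=\sum_\omega h(\omega)o(\omega)$. Lifting of $\mathcal R\subseteq S\times\mathcal D_{sub}(S)$: smallest relation on subdistributions with $\overline s\,\overline{\mathcal R}\,\Delta$ when $s\mathcal R\Delta$, closed under $(\sum_ip_i\Gamma_i)\overline{\mathcal R}(\sum_ip_i\Delta_i)$ for $\Gamma_i\overline{\mathcal R}\Delta_i$, $p_i\in[0,1]$, $\sum_ip_i\le1$, $I$ arbitrary. $\Delta\Rightarrow\Delta'$ iff there are $\Delta_k^\to,\Delta_k^\times$ with $\Delta=\Delta_0^\to+\Delta_0^\times$, $\Delta_k^\to\xrightarrow{\tau}\Delta_{k+1}^\to+\Delta_{k+1}^\times$, $\Delta'=\sum_k\Delta_k^\times$. $\Delta\overset{a}{\Rightarrow}\Delta'$ iff $\Delta\Rightarrow\Delta^{pre}\xrightarrow{a}\Delta^{post}\Rightarrow\Delta'$; $\overset{\tau}{\Rightarrow}$ is $\Rightarrow$. For $A\subseteq\mathsf{Act}$: $s\not\xrightarrow{A}$ iff $s\not\xrightarrow{\alpha}$ for all $\alpha\in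 A\cup\{\tau\}$; $\Delta\not\xrightarrow{A}$ iff this holds for all $s\in\lceil\Delta\rceil$; $\Delta\overset{A}{\not\Rightarrow}$ iff $\Delta\Rightarrow\Delta^{pre}$ with $\Delta^{pre}\not\xrightarrow{A}$. $\lhd_{FS}$ is the largest relation in $\mathbf P\times\mathcal D_{sub}(\mathbf P)$ such that $s\lhd_{FS}\Delta$ implies: (i) if $\overline s\overset{\alpha}{\Rightarrow}\Gamma'$ ($\alpha\in\mathsf{Act}\cup\{\tau\}$) then $\Delta\overset{\alpha}{\Rightarrow}\Delta'$ for some $\Delta'$ with $\Gamma'\,\overline{\lhd_{FS}}\,\Delta'$; (ii) if $\overline s\overset{A}{\not\Rightarrow}$ then $\Delta\overset{A}{\not\Rightarrow}$. $\Delta\sqsubseteq_{FS}\Gamma$ iff $\Delta\Rightarrow\Delta^\natural$ for some $\Delta^\natural$ with $\Gamma\,\overline{\lhd_{FS}}\,\Delta^\natural$. *)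

(* Defs.v *)
(* MathComp-Analysis development; everything is over an abstract [R : realType].
   State spaces are [choiceType]s so that sums over arbitrary (possibly
   uncountable) sets can be written with [\esum]. *)
From HB Require Import structures.
From mathcomp Require Import all_boot all_order all_algebra.
From mathcomp Require Import all_classical all_reals.
From mathcomp Require Import ereal numfun esum.

Set Implicit Arguments.
Unset Strict Implicit.
Unset Printing Implicit Defensive.
Import Order.TTheory GRing.Theory Num.Theory.

Local Open Scope classical_set_scope.
Local Open Scope ring_scope.

(** * Subdistributions *)

(* The bound [D s <= 1] follows from the bound on the total mass. *)
Record subdist (R : realType) (S : choiceType) := Subdist {
  weight :> S -> R ;
  weight_ge0 : forall s, 0 <= weight s ;
  weight_le1 : (\esum_(s in [set: S]) (weight s)%:E <= 1)%E }.

Definition mass (R : realType) (S : choiceType) (D : subdist R S) : \bar R :=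
  (\esum_(s in [set: S]) (D s)%:E)%E.

Definition is_dist (R : realType) (S : choiceType) (D : subdist R S) : Prop :=
  mass D = 1%E.

Definition supp (R : realType) (S : choiceType) (D : subdist R S) : set S :=
  [set s | 0 < D s].

Lemma subdist_ext (R : realType) (S : choiceType) (D E : subdist R S) :
  (forall s, D s = E s) -> D = E.
Proof.
case: D E => [d d0 d1] [e e0 e1] /= de.
have {}de : d = e by apply/funext.
by subst e; congr Subdist; exact: Prop_irrelevance.
Qed.

Lemma esumZl (R : realType) (S : choiceType) (c : R) (a : S -> R) :
  0 <= c -> (forall s, 0 <= a s) ->
  (\esum_(s in [set: S]) (c * a s)%:E =
   c%:E * \esum_(s in [set: S]) (a s)%:E)%E.
Proof.
move=> c0 a0.
have key (k : R) (b : S -> R) : 0 <= k -> (forall s, 0 <= b s) ->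
  (\esum_(s in [set: S]) (k * b s)%:E <=
   k%:E * \esum_(s in [set: S]) (b s)%:E)%E.
  move=> k0 b0; apply: ge_ereal_sup => _ [X [finX _]] <-.
  have -> : (\sum_(x \in X) (k * b x)%:E = k%:E * \sum_(x \in X) (b x)%:E)%E.
    rewrite !fsbig_finite//= ge0_sume_distrr//.
    by move=> i _; rewrite lee_fin.
  apply: lee_wpmul2l; first by rewrite lee_fin.
  by apply: esum_ge; exists X.
have [->|cn0] := eqVneq c 0.
  by rewrite mul0e esum1// => i _; rewrite mul0r.
apply/eqP; rewrite eq_le key//=.
have cV : 0 <= c^-1 by rewrite invr_ge0.
have := key c^-1 (fun s => c * a s) cV (fun s => mulr_ge0 c0 (a0 s)).
under eq_esum do rewrite mulrA mulVf// mul1r.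
move=> h.
have {h} := lee_wpmul2l (x := c%:E) _ h.
rewrite muleA -EFinM divff// mul1e; apply.
by rewrite lee_fin.
Qed.

Lemma pdist_mass (R : realType) (S : choiceType) (s : S) :
  (\esum_(x in [set: S]) ((x == s)%:R : R)%:E = 1)%E.
Proof.
rewrite (eq_esum (b := fun x => if x \in [set s] then (1%:E : \bar R) else 0%E)).
  by rewrite -esum_mkcond esum_set1.
move=> x _; have [->|xs] := eqVneq x s; first by rewrite mem_set.
by rewrite memNset//= => xs'; rewrite xs' eqxx in xs.
Qed.

Definition pdist (R : realType) (S : choiceType) (s : S) : subdist R S.
Proof.
refine (@Subdist R S (fun x => (x == s)%:R) (fun x => ler0n _ _) _).
by rewrite pdist_mass.
Defined.

(* [Exp D f] is only used for [f] with values in [0, 1], where the sum is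
   nonnegative and finite. *)
Definition Exp (R : realType) (S : choiceType) (D : subdist R S) (f : S -> R) : R :=
  fine (\esum_(s in [set: S]) (D s * f s)%:E)%E.

Lemma push_fin (R : realType) (S T : choiceType) (f : S -> T) (D : subdist R S) t :
  ((fine (\esum_(s in f @^-1` [set t]) (D s)%:E))%:E =
   \esum_(s in f @^-1` [set t]) (D s)%:E)%E.
Proof.
rewrite fineK// ge0_fin_numE; last first.
  by apply: esum_ge0 => s _; rewrite lee_fin weight_ge0.
apply: (@le_lt_trans _ _ 1%E); last exact: ltry.
apply: le_trans (weight_le1 D); rewrite [leLHS]esum_mkcond; apply: le_esum => s _.
by case: ifP; rewrite // lee_fin weight_ge0.
Qed.

Lemma push_mass (R : realType) (S T : choiceType) (f : S -> T) (D : subdist R S) :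
  (\esum_(t in [set: T]) (fine (\esum_(s in f @^-1` [set t]) (D s)%:E))%:E = mass D)%E.
Proof.
under eq_esum do rewrite push_fin.
rewrite (esum_esum (a := fun _ s => (D s)%:E)); last first.
  by move=> t s _ _; rewrite lee_fin weight_ge0.
rewrite (@reindex_esum _ _ _ [set: S] _ (fun s => (f s, s)))//; split=> //.
- by move=> s t _ _ [].
- by move=> [t s] /= [_ <-]; exists s.
Qed.

(* [push f D] is the image f(D): t |-> \sum_(f s = t) D s. *)
Definition push (R : realType) (S T : choiceType) (f : S -> T) (D : subdist R S) :
  subdist R T.
Proof.
refine (@Subdist R T
  (fun t => fine (\esum_(s in f @^-1` [set t]) (D s)%:E)%E) _ _).
- by move=> t; apply/fine_ge0/esum_ge0 => s _; rewrite lee_fin weight_ge0.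
- by rewrite push_mass; exact: weight_le1.
Defined.

Lemma prodd_mass (R : realType) (S T : choiceType) (D : subdist R S) (E : subdist R T) :
  (\esum_(x in [set: S * T]) (D x.1 * E x.2)%:E = mass D * mass E)%E.
Proof.
have -> : [set: S * T] = [set: S] `*`` (fun=> [set: T]) by apply/seteqP; split.
rewrite -(@esum_esum R S T setT (fun=> setT) (fun s t => (D s * E t)%:E)); last first.
  by move=> s t _ _; rewrite lee_fin mulr_ge0// weight_ge0.
under eq_esum => s _ do rewrite (esumZl (weight_ge0 D s) (weight_ge0 E)).
have E_ge0 : (0 <= mass E)%E by apply: esum_ge0 => s _; rewrite lee_fin weight_ge0.
have E_fin : mass E \is a fin_num.
  by rewrite ge0_fin_numE// (le_lt_trans (weight_le1 E))// ltry.
rewrite -/(mass E) -(fineK E_fin) muleC -esumZl; last 2 first.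
- exact: fine_ge0.
- exact: weight_ge0.
by apply: eq_esum => s _; rewrite -EFinM mulrC.
Qed.

Definition prodd (R : realType) (S T : choiceType) (D : subdist R S) (E : subdist R T) :
  subdist R (S * T)%type.
Proof.
refine (@Subdist R (S * T)%type (fun x => D x.1 * E x.2) _ _).
- by move=> x; rewrite mulr_ge0// weight_ge0.
- rewrite prodd_mass -[leRHS]mule1; apply: lee_pmul; rewrite ?weight_le1//.
  + by apply: esum_ge0 => s _; rewrite lee_fin weight_ge0.
  + by apply: esum_ge0 => s _; rewrite lee_fin weight_ge0.
Defined.

Lemma is_dist_pdist (R : realType) (S : choiceType) (s : S) : is_dist (pdist R s).
Proof. exact: pdist_mass. Qed.

Lemma is_dist_prodd (R : realType) (S T : choiceType) (D : subdist R S) (E : subdist R T) :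
  is_dist D -> is_dist E -> is_dist (prodd D E).
Proof. by move=> hD hE; rewrite /is_dist /mass /= prodd_mass hD hE mule1. Qed.

(** * Probabilistic labelled transition systems *)

(* A label is [Some a] with [a : L], or [None], which stands for tau. *)
Record pLTS (R : realType) (L : Type) := PLTS {
  state :> choiceType ;
  trans : state -> option L -> subdist R state -> Prop ;
  trans_dist : forall s a D, trans s a D -> is_dist D }.

Definition enabled (R : realType) (L : Type) (P : pLTS R L) (s : P) (a : option L) :
  Prop := exists D, trans s a D.

Definition deterministic (R : realType) (L : Type) (P : pLTS R L) : Prop :=
  forall (s : P) a D E, trans s a D -> trans s a E -> D = E.

Inductive reachable (R : realType) (L : Type) (P : pLTS R L) (D : subdist R P) :
  P -> Prop :=
| reachable_init s : supp D s -> reachable D s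
| reachable_step s a E t :
    reachable D s -> trans s a E -> supp E t -> reachable D t.

Definition finitary (R : realType) (L : Type) (P : pLTS R L) (D : subdist R P) : Prop :=
  finite_set [set s | reachable D s] /\
  forall s, reachable D s -> finite_set [set E | exists a, trans s a E].

(** * Lifting and weak transitions *)

(* The smallest relation on subdistributions extending [Q] (on point
   distributions) and closed under arbitrary subconvex combinations. *)
Inductive lifting (R : realType) (S T : choiceType) (Q : S -> subdist R T -> Prop) :
  subdist R S -> subdist R T -> Prop :=
| lifting_point s E : Q s E -> lifting Q (pdist R s) E
| lifting_sum (I : choiceType) (p : I -> R)
    (Ds : I -> subdist R S) (Es : I -> subdist R T)
    (D : subdist R S) (E : subdist R T) :
    (forall i, 0 <= p i) ->
    (\esum_(i in [set: I]) (p i)%:E <= 1)%E ->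
    (forall i, lifting Q (Ds i) (Es i)) ->
    (forall s, (D s)%:E = \esum_(i in [set: I]) (p i * Ds i s)%:E)%E ->
    (forall t, (E t)%:E = \esum_(i in [set: I]) (p i * Es i t)%:E)%E ->
    lifting Q D E.

Definition ltrans (R : realType) (L : Type) (P : pLTS R L) (a : option L) :
  subdist R P -> subdist R P -> Prop := lifting (fun s E => trans s a E).

(* [D] ==> [D']; here [Ds k] is the sum of the moving part [Dto k] and the
   stopping part [Dx k]. *)
Definition hyper (R : realType) (L : Type) (P : pLTS R L) (D D' : subdist R P) : Prop :=
  exists Ds Dto Dx : nat -> subdist R P,
    [/\ forall k s, Ds k s = Dto k s + Dx k s,
        D = Ds 0%N,
        forall k, ltrans None (Dto k) (Ds k.+1) &
        forall s, ((D' s)%:E = \esum_(k in [set: nat]) (Dx k s)%:E)%E].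

Definition wtrans (R : realType) (L : Type) (P : pLTS R L) (a : option L)
    (D D' : subdist R P) : Prop :=
  if a is Some _ then
    exists Dpre Dpost, [/\ hyper D Dpre, ltrans a Dpre Dpost & hyper Dpost D']
  else hyper D D'.

(* No tau and no action of [A] is possible from any state in the support. *)
Definition refuses (R : realType) (L : Type) (P : pLTS R L) (A : set L)
    (D : subdist R P) : Prop :=
  forall s, supp D s ->
    ~ enabled s None /\ forall a, A a -> ~ enabled s (Some a).

Definition wrefuses (R : realType) (L : Type) (P : pLTS R L) (A : set L)
    (D : subdist R P) : Prop :=
  exists Dpre, hyper D Dpre /\ refuses A Dpre.

(* A reachable distribution is one whose support consists of reachable
   states, the same notion of reachability as in [finitary].  Every state of
   the generated sub-pLTS is thus required not to diverge; asking this only of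
   lifted runs of [D] as a whole would accept 1/2 0 + 1/2 d with d a
   tau-loop. *)
Definition convergent (R : realType) (L : Type) (P : pLTS R L) (D : subdist R P) : Prop :=
  ~ exists Ls : nat -> subdist R P,
      [/\ is_dist (Ls 0%N),
          supp (Ls 0%N) `<=` [set s | reachable D s] &
          forall k, ltrans None (Ls k) (Ls k.+1)].

(** * Failure simulation *)

Definition is_failure_sim (R : realType) (L : Type) (P : pLTS R L)
    (Q : P -> subdist R P -> Prop) : Prop :=
  forall s D, Q s D ->
    (forall a G', wtrans a (pdist R s) G' ->
       exists D', wtrans a D D' /\ lifting Q G' D') /\
    (forall A : set L, wrefuses A (pdist R s) -> wrefuses A D).

(* The largest such relation; the defining condition is monotone, so the union
   of all failure simulations is one. *)
Definition failure_sim (R : realType) (L : Type) (P : pLTS R L)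
    (s : P) (D : subdist R P) : Prop :=
  exists Q : P -> subdist R P -> Prop, is_failure_sim Q /\ Q s D.

Definition fs_le (R : realType) (L : Type) (P : pLTS R L) (D G : subdist R P) : Prop :=
  exists D', hyper D D' /\ lifting (@failure_sim R L P) G D'.

(** * Testing *)

(* Labels of tests are [Act + Om]: [inl] for ordinary actions, [inr] for
   success actions, which makes the two sets (and tau) disjoint. *)
Definition is_test_pLTS (R : realType) (Act Om : Type) (T : pLTS R (Act + Om)) : Prop :=
  (forall (t : T) w1 w2,
     enabled t (Some (inr w1)) -> enabled t (Some (inr w2)) -> w1 = w2) /\
  (forall (t : T) w (a : option Act) D,
     enabled t (Some (inr w)) -> trans t (omap inl a) D ->
     forall u, supp D u -> enabled u (Some (inr w))).

Inductive par_trans (R : realType) (Act Om : Type) (T : pLTS R (Act + Om))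
    (P : pLTS R Act) : T * P -> option Om -> subdist R (T * P)%type -> Prop :=
| par_test t p (w : option Om) D :
    trans t (omap inr w) D -> par_trans (t, p) w (prodd D (pdist R p))
| par_proc t p E :
    trans p None E -> par_trans (t, p) None (prodd (pdist R t) E)
| par_sync t p a D E :
    trans t (Some (inl a)) D -> trans p (Some a) E ->
    par_trans (t, p) None (prodd D E).

Lemma par_trans_dist (R : realType) (Act Om : Type) (T : pLTS R (Act + Om))
    (P : pLTS R Act) (x : T * P) (w : option Om) (D : subdist R (T * P)%type) :
  par_trans x w D -> is_dist D.
Proof.
case=> {x w D} [t p w D tD|t p E pE|t p a D E tD pE]; apply: is_dist_prodd;
  by [exact: is_dist_pdist | exact: trans_dist tD | exact: trans_dist pE].
Qed.

Definition par (R : realType) (Act Om : Type) (T : pLTS R (Act + Om))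
    (P : pLTS R Act) : pLTS R Om :=
  @PLTS R Om (T * P)%type (@par_trans R Act Om T P) (@par_trans_dist R Act Om T P).

Definition is_resolution (R : realType) (Om : Type) (C : pLTS R Om) (D : subdist R C)
    (Q : pLTS R Om) (Lam : subdist R Q) (f : Q -> C) : Prop :=
  [/\ deterministic Q,
      push f Lam = D,
      forall r a E, trans r a E -> trans (f r) a (push f E) &
      forall r a, enabled (f r) a -> enabled r a].

(* In a deterministic pLTS the successor selected by [cid] is the only one. *)
Definition val_op (R : realType) (Om : Type) (Q : pLTS R Om) (V : Q -> Om -> R) :
  Q -> Om -> R := fun r w =>
  if pselect (enabled r (Some w)) then 1
  else if pselect (enabled r None) is left r_tau
       then Exp (sval (cid r_tau)) (fun r' => V r' w)
       else 0.

Definition unit_valued (R : realType) (Q Om : Type) (V : Q -> Om -> R) : Prop :=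
  forall r w, 0 <= V r w <= 1.

(* [V] is the least fixed point of [val_op] among the functions into
   [0, 1]^Om, ordered pointwise. *)
Definition is_valuation (R : realType) (Om : Type) (Q : pLTS R Om) (V : Q -> Om -> R) :
  Prop :=
  [/\ unit_valued V, val_op V = V &
      forall W, unit_valued W -> val_op W = W -> forall r w, V r w <= W r w].

Definition outcomes (R : realType) (Act Om : Type) (T : pLTS R (Act + Om))
    (P : pLTS R Act) (Th : subdist R T) (D : subdist R P) : set (Om -> R) :=
  [set o | exists (Q : pLTS R Om) (Lam : subdist R Q) (f : Q -> par T P)
             (V : Q -> Om -> R),
    [/\ is_resolution (C := par T P) (prodd Th D) Lam f, is_valuation V &
        o = fun w => Exp Lam (fun r => V r w)]].

(* \sum_w h w * o w, as the difference of the sums of its positive and negative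
   parts; it converges absolutely when [h] is bounded and [o] is summable. *)
Definition reward (R : realType) (Om : choiceType) (h o : Om -> R) : \bar R :=
  let g := fun w => (h w * o w)%:E in
  (\esum_(w in [set: Om]) g^\+ w - \esum_(w in [set: Om]) g^\- w)%E.

Definition rrmust_le (R : realType) (Act : Type) (Om : choiceType)
    (T : pLTS R (Act + Om)) (P : pLTS R Act) (D G : subdist R P) : Prop :=
  forall (Th : subdist R T) (h : Om -> R),
    is_dist Th -> (forall w, -1 <= h w <= 1) ->
    (ereal_inf [set reward h o | o in outcomes Th D] <=
     ereal_inf [set reward h o | o in outcomes Th G])%E.

(* Main.v *)
Require Import Defs.
From mathcomp Require Import all_boot all_order all_algebra.
From mathcomp Require Import all_classical all_reals.
From mathcomp Require Import ereal numfun esum lra.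

(* Shift rewards by 1, so that a success [w] pays [k w = h w + 1] in [0, 2] while
   deadlock and divergence pay 1.  On the composed system let [v_0] be a fixed
   point of the minimising Bellman operator for the constant reward 2, and let
   [v_(n+1)] be obtained from [v_n] by the Bellman operator for [k]; these
   decrease to a limit [v].  A time-dependent epsilon-optimal scheduler (optimise
   for [n] steps, then avoid success) shows that the infimum over the resolutions
   of [Th || Delta] is at most [Exp (Th || Delta) v - 1].  Conversely let [U_n x]
   be the least payoff over the states of a given resolution of [Th || Gamma] that
   lie over [x], where successes pay [k] for [n] steps and 2 afterwards; its limit
   is the outcome of that resolution.  It remains to see that
   [Exp D v(t, _) <= U_n (t, p)] when the failure simulation relates [p] to [D].
   This is an induction on [n], as [v] is below its Bellman image and hence can
   only grow along a weak move (weak moves lose no mass, by convergence).  The base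
   case determines the choice of [v_0]: Zorn's lemma gives a fixed point among the
   functions that already satisfy the inequality, and these are closed under the
   Bellman operator because [Gamma] cannot do internal moves forever. *)

Set Implicit Arguments.
Unset Strict Implicit.
Unset Printing Implicit Defensive.
Import Order.TTheory GRing.Theory Num.Theory.
Local Open Scope classical_set_scope.
Local Open Scope ring_scope.

(** * Expectations *)

Definition bdd (R : realType) (S : Type) (c : R) (f : S -> R) :=
  forall s, 0 <= f s <= c.

Lemma esum_swap (R : realType) (I J : choiceType) (a : I -> J -> \bar R) :
  (forall i j, 0 <= a i j)%E ->
  (\esum_(i in [set: I]) \esum_(j in [set: J]) a i j =
   \esum_(j in [set: J]) \esum_(i in [set: I]) a i j)%E.
Proof.
move=> a0; rewrite !esum_esum//.
rewrite (@reindex_esum _ _ _ ([set: J] `*`` (fun=> [set: I])) _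
  (fun x => (x.2, x.1)))//.
split => //=.
- by move=> [j i] [j' i'] _ _ /= [-> ->].
- by move=> [i j] _; exists (j, i).
Qed.

Section Expectation.
Variables (R : realType) (S : choiceType).
Implicit Types (D : subdist R S) (f g : S -> R) (c : R).

Lemma Exp_EFin D f c : bdd c f ->
  ((Exp D f)%:E = \esum_(s in [set: S]) (D s * f s)%:E)%E.
Proof.
move=> fc; rewrite fineK// ge0_fin_numE; last first.
  by apply: esum_ge0 => s _; rewrite lee_fin mulr_ge0 ?weight_ge0//; case/andP: (fc s).
apply: (@le_lt_trans _ _ (`|c|%:E * mass D)%E); last first.
  apply: (@le_lt_trans _ _ (`|c|%:E * 1)%E); last by rewrite mule1 ltry.
  by apply: lee_wpmul2l; [rewrite lee_fin|exact: weight_le1].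
rewrite -esumZl//; last by move=> s; exact: weight_ge0.
apply: le_esum => s _; rewrite lee_fin mulrC ler_wpM2r ?weight_ge0//.
by case/andP: (fc s) => _ /le_trans; apply; exact: ler_norm.
Qed.

Lemma suppP D s : ~ supp D s -> D s = 0.
Proof.
move=> ns; apply/eqP; rewrite eq_le weight_ge0 andbT leNgt.
by apply/negP.
Qed.

Lemma eq_Exp D f g : (forall s, supp D s -> f s = g s) -> Exp D f = Exp D g.
Proof.
move=> fg; congr fine; apply: eq_esum => s _.
by have [/fg->//|/suppP->] := pselect (supp D s); rewrite !mul0r.
Qed.

Lemma Exp_ge0 D f : (forall s, 0 <= f s) -> 0 <= Exp D f.
Proof.
move=> f0; apply/fine_ge0/esum_ge0 => s _.
by rewrite lee_fin mulr_ge0// weight_ge0.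
Qed.

Lemma le_Exp D f g c : bdd c g -> (forall s, 0 <= f s) ->
  (forall s, supp D s -> f s <= g s) -> Exp D f <= Exp D g.
Proof.
move=> gc f0 fg; set f' := fun s => Num.min (f s) (g s).
have -> : Exp D f = Exp D f' by apply: eq_Exp => s /fg; rewrite /f' minEle => ->.
have bf' : bdd c f'.
  move=> s; case/andP: (gc s) => g0 g1; rewrite /f' le_min f0 g0/=.
  by rewrite ge_min g1 orbT.
rewrite -lee_fin (Exp_EFin D bf') (Exp_EFin D gc).
apply: le_esum => s _; rewrite lee_fin ler_wpM2l ?weight_ge0//.
by rewrite /f' ge_min lexx orbT.
Qed.

Lemma Exp_cst D c : 0 <= c -> Exp D (fun=> c) = c * fine (mass D).
Proof.
move=> c0; rewrite /Exp; under eq_esum do rewrite mulrC.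
rewrite esumZl//; last by move=> s; exact: weight_ge0.
have m0 : (0 <= mass D)%E by apply: esum_ge0 => s _; rewrite lee_fin weight_ge0.
by rewrite fineM// ge0_fin_numE// (le_lt_trans (weight_le1 D))// ltry.
Qed.

Lemma fine_mass_le1 D : 0 <= fine (mass D) <= 1.
Proof.
have m0 : (0 <= mass D)%E by apply: esum_ge0 => s _; rewrite lee_fin weight_ge0.
rewrite fine_ge0//= -lee_fin fineK ?weight_le1//.
by rewrite ge0_fin_numE// (le_lt_trans (weight_le1 D))// ltry.
Qed.

Lemma is_distE D : is_dist D <-> fine (mass D) = 1.
Proof.
rewrite /is_dist; split=> [->//|h].
have m0 : (0 <= mass D)%E by apply: esum_ge0 => s _; rewrite lee_fin weight_ge0.
have mf : mass D \is a fin_num.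
  by rewrite ge0_fin_numE// (le_lt_trans (weight_le1 D))// ltry.
by rewrite -[LHS]fineK// h.
Qed.

Lemma Exp_dist D c : is_dist D -> 0 <= c -> Exp D (fun=> c) = c.
Proof. by move=> /is_distE m1 c0; rewrite Exp_cst// m1 mulr1. Qed.

Lemma Exp_le_cst D f c : 0 <= c -> (forall s, 0 <= f s) ->
  (forall s, supp D s -> f s <= c) -> Exp D f <= c.
Proof.
move=> c0 f0 fc; apply: (@le_trans _ _ (Exp D (fun=> c))).
  by apply: (@le_Exp _ _ _ c) => // s; rewrite c0 lexx.
rewrite Exp_cst// -[leRHS]mulr1 ler_wpM2l//.
by case/andP: (fine_mass_le1 D).
Qed.

Lemma bdd_Exp D f c : 0 <= c -> bdd c f -> 0 <= Exp D f <= c.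
Proof.
move=> c0 fc; rewrite Exp_ge0/=; last by move=> s; case/andP: (fc s).
by apply: Exp_le_cst => // s; case/andP: (fc s).
Qed.

Lemma ExpD D f g c c' : bdd c f -> bdd c' g ->
  Exp D (fun s => f s + g s) = Exp D f + Exp D g.
Proof.
move=> fc gc; apply: EFin_inj; rewrite EFinD (Exp_EFin D fc) (Exp_EFin D gc).
rewrite (@Exp_EFin _ _ (c + c')); last first.
  by move=> s; have := fc s; have := gc s; lra.
rewrite -esumD; last 2 first.
- by move=> s _; rewrite lee_fin mulr_ge0 ?weight_ge0//; case/andP: (fc s).
- by move=> s _; rewrite lee_fin mulr_ge0 ?weight_ge0//; case/andP: (gc s).
by apply: eq_esum => s _; rewrite mulrDr EFinD.
Qed.

Lemma ExpZ D f a : 0 <= a -> (forall s, 0 <= f s) ->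
  Exp D (fun s => a * f s) = a * Exp D f.
Proof.
move=> a0 f0; rewrite /Exp.
under eq_esum do rewrite mulrCA.
rewrite esumZl//; last by move=> s; rewrite mulr_ge0 ?weight_ge0.
have [->|an0] := eqVneq a 0; first by rewrite mul0e mul0r.
have apos : 0 < a by rewrite lt_neqAle eq_sym an0.
have : (0 <= \esum_(s in [set: S]) (D s * f s)%:E)%E.
  by apply: esum_ge0 => s _; rewrite lee_fin mulr_ge0 ?weight_ge0.
case: (esum _ _) => [r| |]//= _; last by rewrite mulr0 gt0_muley ?lte_fin.
Qed.

Lemma Exp_supp0 D f : (forall s, 0 <= f s) -> forall c, bdd c f ->
  Exp D f = 0 -> forall s, supp D s -> f s = 0.
Proof.
move=> f0 c fc E0 s Ds; apply/eqP; rewrite eq_le f0 andbT.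
have : ((D s * f s)%:E <= (Exp D f)%:E)%E.
  rewrite (Exp_EFin D fc) -(@esum_set1 _ _ s (fun s => (D s * f s)%:E)); last first.
    by rewrite lee_fin mulr_ge0 ?weight_ge0.
  rewrite [leLHS]esum_mkcond; apply: le_esum => x _.
  by case: ifP => // _; rewrite lee_fin mulr_ge0 ?weight_ge0.
by rewrite E0 lee_fin pmulr_rle0.
Qed.

Lemma Exp_mix (I : choiceType) (p : I -> R) (Ds : I -> subdist R S) D f c :
  (forall i, 0 <= p i) ->
  (forall s, (D s)%:E = \esum_(i in [set: I]) (p i * Ds i s)%:E)%E ->
  bdd c f ->
  ((Exp D f)%:E = \esum_(i in [set: I]) (p i * Exp (Ds i) f)%:E)%E.
Proof.
move=> p0 DE fc.
have f0 s : 0 <= f s by case/andP: (fc s).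
rewrite (Exp_EFin D fc).
transitivity (\esum_(s in [set: S]) \esum_(i in [set: I]) (p i * (Ds i s * f s))%:E)%E.
  apply: eq_esum => s _; rewrite mulrC EFinM DE -esumZl//; last first.
    by move=> i; rewrite mulr_ge0 ?weight_ge0.
  by apply: eq_esum => i _; congr EFin; rewrite mulrC mulrA.
rewrite esum_swap; last by move=> s i; rewrite lee_fin !mulr_ge0 ?weight_ge0.
apply: eq_esum => i _; rewrite EFinM (Exp_EFin (Ds i) fc) -esumZl// => s.
by rewrite mulr_ge0 ?weight_ge0.
Qed.

Lemma Exp_pdist s f : (forall t, 0 <= f t) -> Exp (pdist R s) f = f s.
Proof.
move=> f0; rewrite /Exp.
rewrite (eq_esum (b := fun x => if x \in [set s] then (f s)%:E else 0%E)).
  by rewrite -esum_mkcond esum_set1// lee_fin.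
move=> x _ /=; have [->|xs] := eqVneq x s; first by rewrite mem_set// mul1r.
by rewrite memNset ?mul0r//= => xs'; rewrite xs' eqxx in xs.
Qed.

Lemma supp_pdist (s t : S) : supp (pdist R s) t <-> t = s.
Proof.
rewrite /supp /=; split; last by move=> ->; rewrite eqxx ltr01.
by case: eqP => //; rewrite ltxx.
Qed.

End Expectation.

Lemma chain_sum (R : realType) (S : choiceType) (a : S -> R) (A : set (S -> R))
    (c K : R) :
  (forall s, 0 <= a s) -> (forall f, A f -> bdd c f) -> A !=set0 ->
  (forall f g, A f -> A g -> (forall s, f s <= g s) \/ (forall s, g s <= f s)) ->
  forall (l : seq S) (k : R),
  (forall f, A f -> k + \sum_(s <- l) a s * f s <= K) ->
  k + \sum_(s <- l) a s * sup [set f s | f in A] <= K.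
Proof.
move=> a0 Ac [f1 Af1] tot; elim=> [|x l IH] k h.
  by move: (h _ Af1); rewrite !big_nil.
rewrite big_cons addrA; set X := \sum_(_ <- _) _.
have ubA s : has_ubound [set f s | f in A].
  by exists c => _ [f Af <-]; case/andP: (Ac _ Af s).
have key g : A g -> k + a x * g x + X <= K.
  move=> Ag; apply: IH => f Af.
  case: (tot f g Af Ag) => fg.
  - apply: le_trans (h _ Ag); rewrite big_cons addrA lerD2l.
    by apply: ler_sum => s _; rewrite ler_wpM2l.
  - apply: le_trans (h _ Af); rewrite big_cons addrA lerD2r lerD2l.
    by rewrite ler_wpM2l.
have [ax0|axn0] := eqVneq (a x) 0.
  by have := key _ Af1; rewrite ax0 !mul0r.
have axp : 0 < a x by rewrite lt_neqAle eq_sym axn0 a0.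
suff : sup [set f x | f in A] <= (K - X - k) / a x.
  by rewrite ler_pdivlMr// mulrC; lra.
apply: ge_sup; first by exists (f1 x), f1.
by move=> _ [g Ag <-]; rewrite ler_pdivlMr// mulrC; have := key _ Ag; lra.
Qed.

Lemma esum_sup_chain (R : realType) (S : choiceType) (a : S -> R) (A : set (S -> R))
    (c K : R) :
  (forall s, 0 <= a s) -> (forall f, A f -> bdd c f) -> A !=set0 ->
  (forall f g, A f -> A g -> (forall s, f s <= g s) \/ (forall s, g s <= f s)) ->
  (forall f, A f -> \esum_(s in [set: S]) (a s * f s)%:E <= K%:E)%E ->
  (\esum_(s in [set: S]) (a s * sup [set f s | f in A])%:E <= K%:E)%E.
Proof.
move=> a0 Ac A0 tot h; apply: ge_ereal_sup => _ [X [finX _]] <-.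
rewrite fsbig_finite//= sumEFin lee_fin -[leLHS]add0r.
apply: (chain_sum a0 Ac A0 tot) => f Af; rewrite add0r.
rewrite -lee_fin; apply: le_trans (h _ Af).
rewrite -sumEFin -(fsbig_finite _ (fun s => (a s * f s)%:E))//.
by apply: esum_ge; exists X.
Qed.

Section MonotoneConvergence.
Variables (R : realType) (S : choiceType).
Implicit Types (D : subdist R S).

Lemma Exp_sup_chain D (A : set (S -> R)) (c K : R) :
  (forall f, A f -> bdd c f) -> A !=set0 ->
  (forall f g, A f -> A g -> (forall s, f s <= g s) \/ (forall s, g s <= f s)) ->
  (forall f, A f -> Exp D f <= K) ->
  Exp D (fun s => sup [set f s | f in A]) <= K.
Proof.
move=> Ac A0 tot h; have [f1 Af1] := A0.
have b : bdd c (fun s => sup [set f s | f in A]).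
  move=> s; apply/andP; split.
    apply: (@le_trans _ _ (f1 s)); first by case/andP: (Ac _ Af1 s).
    apply: ub_le_sup; last by exists f1.
    by exists c => _ [f Af <-]; case/andP: (Ac _ Af s).
  apply: ge_sup; first by exists (f1 s), f1.
  by move=> _ [f Af <-]; case/andP: (Ac _ Af s).
rewrite -lee_fin (Exp_EFin D b).
apply: (esum_sup_chain (weight_ge0 D) Ac A0 tot) => f Af.
by rewrite -(Exp_EFin D (Ac _ Af)) lee_fin h.
Qed.

Lemma nondec_chain (f : nat -> S -> R) : (forall n s, f n s <= f n.+1 s) ->
  forall m n, (m <= n)%N -> forall s, f m s <= f n s.
Proof.
move=> h m n /subnK <- s; elim: (n - m)%N => [//|k IH].
by rewrite addSn (le_trans IH).
Qed.

Lemma range_sup (f : nat -> S -> R) c s : (forall n, bdd c (f n)) ->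
  forall n, f n s <= sup (range (f^~ s)) <= c.
Proof.
move=> fc n; apply/andP; split.
  by apply: ub_le_sup; [exists c => _ [m _ <-]; case/andP: (fc m s)|exists n].
apply: ge_sup; first by exists (f 0%N s), 0%N.
by move=> _ [m _ <-]; case/andP: (fc m s).
Qed.

Lemma Exp_sup D (f : nat -> S -> R) (c K : R) :
  (forall n, bdd c (f n)) -> (forall n s, f n s <= f n.+1 s) ->
  (forall n, Exp D (f n) <= K) -> Exp D (fun s => sup (range (f^~ s))) <= K.
Proof.
move=> fc fn h.
have -> : (fun s => sup (range (f^~ s))) = (fun s => sup [set g s | g in range f]).
  by apply/funext => s; rewrite image_comp.
apply: (@Exp_sup_chain _ _ c).
- by move=> _ [n _ <-].
- by exists (f 0%N), 0%N.
- move=> _ _ [m _ <-] [n _ <-].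
  by have [mn|/ltnW nm] := leqP m n; [left|right]; exact: nondec_chain.
- by move=> _ [n _ <-].
Qed.

Lemma range_inf (f : nat -> S -> R) c s : (forall n, bdd c (f n)) ->
  forall n, 0 <= inf (range (f^~ s)) <= f n s.
Proof.
move=> fc n; apply/andP; split.
  apply: lb_le_inf; first by exists (f 0%N s), 0%N.
  by move=> _ [m _ <-]; case/andP: (fc m s).
by apply: ge_inf; [exists 0 => _ [m _ <-]; case/andP: (fc m s)|exists n].
Qed.

Lemma Exp_inf D (f : nat -> S -> R) (c K : R) :
  (forall n, bdd c (f n)) -> (forall n s, f n.+1 s <= f n s) ->
  (forall n, K <= Exp D (f n)) -> K <= Exp D (fun s => inf (range (f^~ s))).
Proof.
move=> fc fn h.
have [s0|nS] := pselect (exists s : S, True); last first.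
  have -> : Exp D (fun s => inf (range (f^~ s))) = Exp D (f 0%N); last exact: h.
  by apply: eq_Exp => s; case: nS; exists s.
have c0 : 0 <= c by have [s _] := s0; have := fc 0%N s; lra.
have gc n : bdd c (fun s => c - f n s) by move=> s; have := fc n s; lra.
have bi : bdd c (fun s => inf (range (f^~ s))).
  by move=> s; have := range_inf s fc 0%N; have := fc 0%N s; lra.
have tot g : bdd c g -> Exp D g + Exp D (fun s => c - g s) = Exp D (fun=> c).
  move=> bg; rewrite -(@ExpD _ _ _ _ _ c c)//; last first.
    by move=> s; have := bg s; lra.
  by apply: eq_Exp => s _; lra.
have supE s : sup (range (fun n => c - f n s)) = c - inf (range (f^~ s)).
  apply/eqP; rewrite eq_le; apply/andP; split.
    apply: ge_sup; first by exists (c - f 0%N s), 0%N.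
    by move=> _ [n _ <-]; have := range_inf s fc n; lra.
  suff : c - sup (range (fun n => c - f n s)) <= inf (range (f^~ s)) by lra.
  apply: lb_le_inf; first by exists (f 0%N s), 0%N.
  by move=> _ [n _ <-]; have := range_sup s gc n; lra.
have H : Exp D (fun s => c - inf (range (f^~ s))) <= Exp D (fun=> c) - K.
  rewrite (_ : (fun s => _) = (fun s => sup (range (fun n => c - f n s)))).
    apply: (@Exp_sup D (fun n s => c - f n s) c _ gc).
      by move=> n s; have := fn n s; lra.
    by move=> n; have := h n; have := tot _ (fc n); lra.
  by apply/funext => s; rewrite supE.
by have := tot _ bi; lra.
Qed.

End MonotoneConvergence.

Section Constructions.
Variable R : realType.

Lemma Exp_prodd (S T : choiceType) (D : subdist R S) (E : subdist R T) f c :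
  0 <= c -> bdd c f ->
  Exp (prodd D E) f = Exp D (fun s => Exp E (fun t => f (s, t))).
Proof.
move=> c0 fc; apply: EFin_inj; rewrite (Exp_EFin _ fc).
rewrite (@Exp_EFin _ _ _ _ c); last by move=> s; apply: bdd_Exp.
have f0 x : 0 <= f x by case/andP: (fc x).
have -> : [set: S * T] = [set: S] `*`` (fun=> [set: T]) by apply/seteqP; split.
rewrite (eq_esum (b := fun x => (fun s t => (D s * (E t * f (s, t)))%:E) x.1 x.2)).
  rewrite -(@esum_esum R S T setT (fun=> setT)
    (fun s t => (D s * (E t * f (s, t)))%:E)); last first.
    by move=> s t _ _; rewrite lee_fin !mulr_ge0// weight_ge0.
  apply: eq_esum => s _; rewrite EFinM (@Exp_EFin _ _ _ _ c)//.
  by rewrite -esumZl ?weight_ge0// => t; rewrite mulr_ge0 ?weight_ge0.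
by move=> [s t] _ /=; rewrite mulrA.
Qed.

Lemma Exp_swap (S T : choiceType) (D : subdist R S) (E : subdist R T) f c :
  0 <= c -> (forall s, bdd c (f s)) ->
  Exp D (fun s => Exp E (fun t => f s t)) = Exp E (fun t => Exp D (fun s => f s t)).
Proof.
move=> c0 fc; have f0 s t : 0 <= f s t by case/andP: (fc s t).
have fc' t : bdd c (f^~ t) by move=> s; exact: fc.
apply: EFin_inj; rewrite !(@Exp_EFin _ _ _ _ c); try by move=> ?; exact: bdd_Exp.
transitivity (\esum_(s in [set: S]) \esum_(t in [set: T]) (D s * (E t * f s t))%:E)%E.
  apply: eq_esum => s _; rewrite EFinM (Exp_EFin E (fc s)) -esumZl ?weight_ge0//.
  by move=> t; rewrite mulr_ge0 ?weight_ge0.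
rewrite esum_swap; last by move=> s t; rewrite lee_fin !mulr_ge0 ?weight_ge0.
apply: eq_esum => t _; rewrite EFinM (Exp_EFin D (fc' t)) -esumZl ?weight_ge0//.
  by apply: eq_esum => s _; rewrite mulrCA.
by move=> s; rewrite mulr_ge0 ?weight_ge0.
Qed.

Lemma bdd_weight (S T : choiceType) (K : S -> subdist R T) t : bdd 1 (fun s => K s t).
Proof.
move=> s; rewrite weight_ge0/= -lee_fin; apply: le_trans (weight_le1 (K s)).
rewrite -(@esum_set1 _ _ t (fun t => (K s t)%:E)) ?lee_fin ?weight_ge0//.
rewrite [leLHS]esum_mkcond; apply: le_esum => x _.
by case: ifP => // _; rewrite lee_fin weight_ge0.
Qed.

Lemma bind_mass (S T : choiceType) (D : subdist R S) (K : S -> subdist R T) :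
  (\esum_(t in [set: T]) (Exp D (fun s => K s t))%:E =
   (Exp D (fun s => fine (mass (K s))))%:E)%E.
Proof.
under eq_esum => t _ do rewrite (Exp_EFin D (bdd_weight K t)).
rewrite esum_swap; last by move=> s i; rewrite lee_fin mulr_ge0 ?weight_ge0.
rewrite (@Exp_EFin _ _ _ _ 1); last by move=> s; exact: fine_mass_le1.
apply: eq_esum => s _; rewrite EFinM esumZl ?weight_ge0//; last exact: weight_ge0.
rewrite fineK// ge0_fin_numE ?(le_lt_trans (weight_le1 (K s))) ?ltry//.
by apply: esum_ge0 => t _; rewrite lee_fin weight_ge0.
Qed.

Definition bind (S T : choiceType) (D : subdist R S) (K : S -> subdist R T) :
  subdist R T.
Proof.
refine (@Subdist R T (fun t => Exp D (fun s => K s t)) _ _).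
- by move=> t; apply: Exp_ge0 => s; exact: weight_ge0.
- rewrite bind_mass lee_fin Exp_le_cst// => s.
    by case/andP: (fine_mass_le1 (K s)).
  by case/andP: (fine_mass_le1 (K s)).
Defined.

Lemma bind_mixE (S T : choiceType) (D : subdist R S) (K : S -> subdist R T) t :
  ((bind D K t)%:E = \esum_(s in [set: S]) (D s * K s t)%:E)%E.
Proof. by rewrite /bind /= (Exp_EFin D (bdd_weight K t)). Qed.

Lemma Exp_bind (S T : choiceType) (D : subdist R S) (K : S -> subdist R T) f c :
  0 <= c -> bdd c f -> Exp (bind D K) f = Exp D (fun s => Exp (K s) f).
Proof.
move=> c0 fc; apply: EFin_inj.
rewrite (Exp_mix (weight_ge0 D) (bind_mixE D K) fc).
by rewrite (@Exp_EFin _ _ _ _ c)// => s; exact: bdd_Exp.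
Qed.

Lemma is_dist_bind (S T : choiceType) (D : subdist R S) (K : S -> subdist R T) :
  is_dist D -> (forall s, supp D s -> is_dist (K s)) -> is_dist (bind D K).
Proof.
move=> D1 K1; rewrite /is_dist /mass /= bind_mass; congr EFin.
rewrite (@eq_Exp _ _ _ _ (fun=> 1)) ?Exp_dist//.
by move=> s /K1/is_distE.
Qed.

Lemma supp_bind (S T : choiceType) (D : subdist R S) (K : S -> subdist R T) t :
  supp (bind D K) t -> exists2 s, supp D s & supp (K s) t.
Proof.
move=> st; apply: contrapT => h; move: st; rewrite /supp /=.
rewrite (@eq_Exp _ _ _ _ (fun=> 0)) ?Exp_cst// ?mul0r ?ltxx// => s Ds.
by apply: suppP => Kt; apply: h; exists s.
Qed.

Lemma push_bind (S T : choiceType) (f : S -> T) (D : subdist R S) :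
  push f D = bind D (fun s => pdist R (f s)).
Proof.
apply: subdist_ext => t /=; congr fine; rewrite esum_mkcond.
apply: eq_esum => s _; case: ifP => [/set_mem /= ->|].
  by rewrite eqxx mulr1.
by case: eqP => [->|_]; rewrite ?mulr0// mem_set.
Qed.

Lemma Exp_push (S T : choiceType) (f : S -> T) (D : subdist R S) g c :
  0 <= c -> bdd c g -> Exp (push f D) g = Exp D (g \o f).
Proof.
move=> c0 gc; rewrite push_bind (Exp_bind _ _ c0 gc).
by apply: eq_Exp => s _; rewrite Exp_pdist// => t; case/andP: (gc t).
Qed.

Lemma bind_pdist (S : choiceType) (D : subdist R S) : bind D (fun s => pdist R s) = D.
Proof.
apply: subdist_ext => s; apply: EFin_inj; rewrite bind_mixE.
rewrite (eq_esum (b := fun x => if x \in [set s] then (D s)%:E else 0%E)).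
  by rewrite -esum_mkcond esum_set1// lee_fin weight_ge0.
move=> x _ /=; rewrite eq_sym; have [->|xs] := eqVneq x s.
  by rewrite mem_set// mulr1.
by rewrite memNset ?mulr0//= => xs'; rewrite xs' eqxx in xs.
Qed.

Lemma push_comp_id (S T : choiceType) (f : S -> T) (g : T -> S) (D : subdist R S) :
  cancel f g -> push g (push f D) = D.
Proof.
move=> fK; rewrite -[RHS]bind_pdist; apply: subdist_ext => s.
rewrite push_bind /= (@Exp_push _ _ _ _ _ 1)//; last first.
  exact: (bdd_weight (fun t => pdist R (g t))).
by apply: eq_Exp => x _ /=; rewrite fK.
Qed.

Lemma supp_push_in (S T : choiceType) (f : S -> T) (D : subdist R S) s :
  supp D s -> supp (push f D) (f s).
Proof.
move=> Ds; rewrite /supp push_bind /= lt_neqAle eq_sym.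
rewrite Exp_ge0 ?andbT; last by move=> x; rewrite ler0n.
apply/eqP => E0; have := @Exp_supp0 _ _ D (fun x => (f s == f x)%:R) _ 1 _ E0 s Ds.
rewrite eqxx => H; have /eqP : 1 = 0 :> R.
  by apply: H => x; rewrite ?ler0n ?lern1 ?leq_b1.
by rewrite oner_eq0.
Qed.

Definition zerod (S : choiceType) : subdist R S.
Proof.
refine (@Subdist R S (fun=> 0) (fun=> lexx _) _).
by rewrite esum1.
Defined.

End Constructions.

(** * Lifting and convergence *)

Section Lifting.
Variables (R : realType).

Lemma mix_supp (I S : choiceType) (p : I -> R) (Ds : I -> subdist R S)
    (D : subdist R S) :
  (forall i, 0 <= p i) ->
  (forall s, (D s)%:E = \esum_(i in [set: I]) (p i * Ds i s)%:E)%E ->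
  forall i, 0 < p i -> supp (Ds i) `<=` supp D.
Proof.
move=> p0 DE i pi s Dis; rewrite /supp /= -lte_fin DE.
apply: (@lt_le_trans _ _ (p i * Ds i s)%:E); first by rewrite lte_fin mulr_gt0.
rewrite -(@esum_set1 _ _ i (fun i => (p i * Ds i s)%:E)); last first.
  by rewrite lee_fin mulr_ge0 ?weight_ge0.
rewrite [leLHS]esum_mkcond; apply: le_esum => x _.
by case: ifP => // _; rewrite lee_fin mulr_ge0 ?weight_ge0.
Qed.

Lemma mix_supp_ex (I S : choiceType) (p : I -> R) (Ds : I -> subdist R S)
    (D : subdist R S) s :
  (forall i, 0 <= p i) ->
  (forall s, (D s)%:E = \esum_(i in [set: I]) (p i * Ds i s)%:E)%E ->
  supp D s -> exists2 i, 0 < p i & supp (Ds i) s.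
Proof.
move=> p0 DE Ds0; apply: contrapT => h; move: Ds0.
rewrite /supp /= -lte_fin DE esum1 ?ltxx// => i _.
have [pi|] := ltP 0 (p i).
  by rewrite suppP ?mulr0// => Dis; apply: h; exists i.
by move=> pi; rewrite (_ : p i = 0) ?mul0r//; apply/eqP; rewrite eq_le pi p0.
Qed.

Lemma lifting_mono (S T : choiceType) (Q Q' : S -> subdist R T -> Prop) D E :
  (forall s E, Q s E -> Q' s E) -> lifting Q D E -> lifting Q' D E.
Proof.
move=> QQ'; elim=> {D E} [s E /QQ' ?|I p Ds Es D E p0 p1 _ IH DE EE].
  exact: lifting_point.
exact: lifting_sum p0 p1 IH DE EE.
Qed.

Lemma lifting0 (S T : choiceType) (Q : S -> subdist R T -> Prop) :
  lifting Q (zerod R S) (zerod R T).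
Proof.
apply: (@lifting_sum _ _ _ _ void (fun=> 0) (fun=> zerod R S) (fun=> zerod R T)) => //=.
- by rewrite esum1// lee01.
- by move=> s; rewrite esum1.
- by move=> s; rewrite esum1.
Qed.

Lemma lifting_bind (S T : choiceType) (Q : S -> subdist R T -> Prop) D K :
  (forall s, supp D s -> Q s (K s)) -> lifting Q D (bind D K).
Proof.
move=> QK.
pose Ds s := if pselect (supp D s) then pdist R s else zerod R S.
pose Es s := if pselect (supp D s) then K s else zerod R T.
apply: (@lifting_sum _ _ _ _ S D Ds Es).
- exact: weight_ge0.
- exact: weight_le1.
- move=> s; rewrite /Ds /Es; case: (pselect (supp D s)) => /= [Dss|_].
    exact/lifting_point/QK.
  exact: lifting0.
- move=> s; rewrite -[in LHS](bind_pdist D) bind_mixE.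
  apply: eq_esum => x _; congr EFin.
  by rewrite /Ds; case: (pselect (supp D x)) => //= nDx; rewrite (suppP nDx) !mul0r.
- move=> t; rewrite bind_mixE; apply: eq_esum => x _; congr EFin.
  by rewrite /Es; case: (pselect (supp D x)) => //= nDx; rewrite (suppP nDx) !mul0r.
Qed.

Lemma lifting_supp (S T : choiceType) (Q : S -> subdist R T -> Prop)
    (X : set S) (Y : set T) D E :
  (forall s E, X s -> Q s E -> supp E `<=` Y) ->
  lifting Q D E -> supp D `<=` X -> supp E `<=` Y.
Proof.
move=> QXY; elim=> {D E} [s E sE DX|I p Ds Es D E p0 p1 _ IH DE EE DX].
  by apply: QXY sE; apply: DX; exact/supp_pdist.
move=> t /(mix_supp_ex p0 EE)[i pi Eit]; apply: IH Eit.
exact: subset_trans (mix_supp p0 DE pi) DX.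
Qed.

Lemma lifting_Exp_ge (S T : choiceType) (Q : S -> subdist R T -> Prop)
    (X : set S) f g c c' D E :
  bdd c f -> bdd c' g -> (forall s E, X s -> Q s E -> f s <= Exp E g) ->
  lifting Q D E -> supp D `<=` X -> Exp D f <= Exp E g.
Proof.
move=> fc gc Qfg; elim=> {D E} [s E sE DX|I p Ds Es D E p0 p1 _ IH DE EE DX].
  rewrite Exp_pdist; first by apply: Qfg sE; apply: DX; exact/supp_pdist.
  by move=> t; case/andP: (fc t).
rewrite -lee_fin (Exp_mix p0 DE fc) (Exp_mix p0 EE gc).
apply: le_esum => i _; rewrite lee_fin.
have [->|pn0] := eqVneq (p i) 0; first by rewrite !mul0r.
have pi : 0 < p i by rewrite lt_neqAle eq_sym pn0 p0.
rewrite ler_wpM2l// IH//.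
exact: subset_trans (mix_supp p0 DE pi) DX.
Qed.

Lemma bdd1 (S : Type) : bdd 1 (fun=> 1 : R) (S := S).
Proof. by move=> s; rewrite ler01 lexx. Qed.

Lemma dist1 (S : choiceType) (D : subdist R S) : is_dist D <-> Exp D (fun=> 1) = 1.
Proof. by rewrite is_distE Exp_cst// mul1r. Qed.

Lemma lifting_mass (S T : choiceType) (Q : S -> subdist R T -> Prop) D E :
  lifting Q D E -> Exp E (fun=> 1) <= Exp D (fun=> 1).
Proof.
elim=> {D E} [s E sE|I p Ds Es D E p0 p1 _ IH DE EE].
  by rewrite Exp_pdist// Exp_le_cst.
rewrite -lee_fin (Exp_mix p0 DE (@bdd1 _)) (Exp_mix p0 EE (@bdd1 _)).
by apply: le_esum => i _; rewrite lee_fin ler_wpM2l.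
Qed.

Lemma esum_le_eq (I : choiceType) (a b : I -> R) :
  (forall i, 0 <= a i <= b i) ->
  (\esum_(i in [set: I]) (b i)%:E <= \esum_(i in [set: I]) (a i)%:E)%E ->
  (\esum_(i in [set: I]) (a i)%:E < +oo)%E -> forall i, b i <= a i.
Proof.
move=> ab ba afin i.
have bE : (\esum_(i in [set: I]) (b i)%:E =
    \esum_(i in [set: I]) (a i)%:E + \esum_(i in [set: I]) (b i - a i)%:E)%E.
  rewrite -esumD; last 2 first.
  - by move=> j _; rewrite lee_fin; have := ab j; lra.
  - by move=> j _; rewrite lee_fin; have := ab j; lra.
  by apply: eq_esum => j _; rewrite -EFinD; congr EFin; lra.
have a_fin : (\esum_(i in [set: I]) (a i)%:E)%E \is a fin_num.
  rewrite ge0_fin_numE//; apply: esum_ge0 => j _.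
  by rewrite lee_fin; have := ab j; lra.
move: ba; rewrite bE -[leRHS]adde0 leeD2lE// => h.
rewrite -subr_le0 -lee_fin; apply: le_trans h.
rewrite -(@esum_set1 _ _ i (fun i => (b i - a i)%:E)); last first.
  by rewrite lee_fin; have := ab i; lra.
rewrite [leLHS]esum_mkcond; apply: le_esum => x _.
by case: ifP => // _; rewrite lee_fin; have := ab x; lra.
Qed.

(* Requiring that no mass is lost forces every component of the lifting that has
   positive weight to be related to a full distribution. *)
Lemma lifting_Exp_le (S T : choiceType) (Q : S -> subdist R T -> Prop)
    (X : set S) (Y : set T) f g c c' D E :
  bdd c f -> bdd c' g ->
  (forall s E, X s -> supp E `<=` Y -> is_dist E -> Q s E -> Exp E g <= f s) ->
  lifting Q D E -> supp D `<=` X -> supp E `<=` Y ->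
  Exp D (fun=> 1) <= Exp E (fun=> 1) -> Exp E g <= Exp D f.
Proof.
move=> fc gc Qfg; elim=> {D E} [s E sE DX EY m|I p Ds Es D E p0 p1 lE IH DE EE DX EY m].
  rewrite Exp_pdist; last by move=> t; case/andP: (fc t).
  apply: Qfg sE => //; first by apply: DX; exact/supp_pdist.
  apply/dist1/eqP; rewrite eq_le Exp_le_cst//=.
  by rewrite Exp_pdist// in m.
rewrite -lee_fin (Exp_mix p0 DE fc) (Exp_mix p0 EE gc).
have pm i : p i * Exp (Ds i) (fun=> 1) <= p i * Exp (Es i) (fun=> 1).
  apply: (@esum_le_eq I (fun i => p i * Exp (Es i) (fun=> 1))
    (fun i => p i * Exp (Ds i) (fun=> 1))).
  - move=> j; rewrite mulr_ge0 ?Exp_ge0//= ler_wpM2l//.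
    exact: lifting_mass (lE j).
  - by rewrite -(Exp_mix p0 DE (@bdd1 _)) -(Exp_mix p0 EE (@bdd1 _)) lee_fin.
  - by rewrite -(Exp_mix p0 EE (@bdd1 _)) ltry.
apply: le_esum => i _; rewrite lee_fin.
have [->|pn0] := eqVneq (p i) 0; first by rewrite !mul0r.
have pi : 0 < p i by rewrite lt_neqAle eq_sym pn0 p0.
rewrite ler_wpM2l// IH//.
- exact: subset_trans (mix_supp p0 DE pi) DX.
- exact: subset_trans (mix_supp p0 EE pi) EY.
- by have := pm i; rewrite ler_pM2l.
Qed.

End Lifting.

Lemma finite_max d (T : orderType d) (A : set T) : finite_set A -> A !=set0 ->
  exists2 x, A x & forall y, A y -> (y <= x)%O.
Proof.
move=> /finite_seqP[l ->]; elim: l => [[x]//|a l IH _].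
have [l0|ln] := pselect ([set` l] !=set0).
  have [x /= xl xmax] := IH l0.
  have [ax|/ltW xa] := leP a x.
    exists x => /=; first by rewrite inE xl orbT.
    by move=> y /=; rewrite inE => /orP[/eqP->//|]; exact: xmax.
  exists a => /=; first by rewrite inE eqxx.
  move=> y /=; rewrite inE => /orP[/eqP->//|/xmax]; move=> /le_trans; exact.
exists a => /=; first by rewrite inE eqxx.
move=> y /=; rewrite inE => /orP[/eqP->//|yl].
by case: ln; exists y.
Qed.

Section Convergence.
Variables (R : realType) (L : Type) (P : pLTS R L) (D0 : subdist R P).
Hypothesis D0_fin : finitary D0.
Hypothesis D0_conv : convergent D0.

Local Notation X := [set p | reachable D0 p].

Lemma reach_finite_tau p : X p -> finite_set [set E | trans p None E].
Proof.
move=> Xp; apply: sub_finite_set (D0_fin.2 p Xp) => E pE; by exists None.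
Qed.

Lemma reach_trans p a E : X p -> trans p a E -> supp E `<=` X.
Proof. by move=> Xp pE q Eq; exact: reachable_step Xp pE Eq. Qed.

Lemma no_tau_closed_set (Y : set P) :
  Y `<=` X -> (forall p, Y p -> exists2 E, trans p None E & supp E `<=` Y) ->
  forall p, ~ Y p.
Proof.
move=> YX Yt p Yp.
have /choice[K KP] : forall p, exists E, Y p -> trans p None E /\ supp E `<=` Y.
  move=> q; have [/Yt[E qE EY]|] := pselect (Y q); first by exists E.
  by exists (pdist R q).
pose Ls := fix Ls n := if n is n'.+1 then bind (Ls n') K else pdist R p.
have LY n : supp (Ls n) `<=` Y.
  elim: n => [q /supp_pdist ->//|n IH q /= /supp_bind[s /IH Ys Ks]].
  exact: (KP s Ys).2.
apply: D0_conv; exists Ls; split.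
- exact: is_dist_pdist.
- exact: subset_trans (LY 0%N) YX.
- by move=> k; apply: lifting_bind => s /LY/KP[].
Qed.

(* The states at which [m] is maximal would otherwise form a set that an internal
   run never has to leave, contradicting [no_tau_closed_set]. *)
Lemma no_drift (m : P -> R) (c : R) : 0 <= c -> bdd c m ->
  (forall p, X p -> forall b, 0 <= b ->
     (forall E, trans p None E -> Exp E m <= b) -> m p <= b) ->
  forall p, X p -> m p = 0.
Proof.
move=> c0 mc drift p0 Xp0.
have m0 p : 0 <= m p by case/andP: (mc p).
have [_ [p1 Xp1 <-] maxp1] : exists2 x, (m @` X) x & forall y, (m @` X) y -> y <= x.
  apply: finite_max; first exact/finite_image/(D0_fin.1).
  by exists (m p0), p0.
have {}maxp1 p : X p -> m p <= m p1 by move=> Xp; apply: maxp1; exists p.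
apply/eqP; rewrite eq_le m0 andbT; apply: le_trans (maxp1 _ Xp0) _.
rewrite leNgt; apply/negP => mpos.
apply: (@no_tau_closed_set [set p | X p /\ m p = m p1] _ _ p1) => //.
  by move=> p [].
move=> p [Xp mp]; apply: contrapT => nE.
have lt1 E : trans p None E -> Exp E m < m p1.
  move=> pE; have EX := reach_trans Xp pE.
  rewrite ltNge; apply/negP => le1; apply: nE; exists E => // q Eq.
  split; first exact: EX.
  pose g q := m p1 - Num.min (m q) (m p1).
  have gE q' : 0 <= g q' <= m p1.
    rewrite /g; have := m0 q'; have : Num.min (m q') (m p1) <= m p1.
      by rewrite ge_min lexx orbT.
    have : 0 <= Num.min (m q') (m p1) by rewrite le_min !m0.
    lra.
  have Emg : Exp E m + Exp E g = m p1.
    rewrite -(@ExpD _ _ E m g c (m p1))// -[RHS](Exp_dist (trans_dist pE) (m0 p1)).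
    by apply: eq_Exp => s /EX/maxp1 /min_l; rewrite /g => ->; lra.
  have g0 : Exp E g = 0.
    apply/eqP; rewrite eq_le Exp_ge0 ?andbT; last by move=> s; case/andP: (gE s).
    lra.
  have := @Exp_supp0 _ _ E g _ _ gE g0 q Eq.
  move=> /(_ (fun s => proj1 (andP (gE s)))).
  by rewrite /g min_l ?maxp1//; [lra|exact: EX].
pose B := 0 |` ((fun E => Exp E m) @` [set E | trans p None E]).
have [b Bb bmax] : exists2 x, B x & forall y, B y -> y <= x.
  apply: finite_max; last by exists 0; left.
  rewrite finite_setU; split => //.
  exact/finite_image/reach_finite_tau.
have blt : b < m p1 by case: Bb => [->//|[E pE <-]]; exact: lt1.
suff : m p <= b by rewrite mp leNgt blt.
apply: drift => //; first by apply: bmax; left.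
by move=> E pE; apply: bmax; right; exists E.
Qed.

(* The largest probability with which a scheduler can perform [n] internal moves. *)
Fixpoint stay (n : nat) (p : P) : R :=
  if n is n'.+1 then
    sup [set z | z = 0 \/ exists2 E, trans p None E & z = Exp E (stay n')]
  else 1.

Lemma stay_bdd n : bdd 1 (stay n).
Proof.
elim: n => [|n IH] p /=; first by rewrite ler01 lexx.
have ub : ubound [set z | z = 0 \/ exists2 E, trans p None E & z = Exp E (stay n)] 1.
  by move=> _ [->//|[E _ ->]]; case/andP: (bdd_Exp E ler01 IH).
apply/andP; split; last by apply: ge_sup => //; exists 0; left.
by apply: ub_le_sup; [exists 1|left].
Qed.

Lemma stay_step n p E : trans p None E -> Exp E (stay n) <= stay n.+1 p.
Proof.
move=> pE; apply: ub_le_sup; last by right; exists E.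
by exists 1 => _ [->//|[F _ ->]]; case/andP: (bdd_Exp F ler01 (stay_bdd n)).
Qed.

Lemma stay_le n p b : 0 <= b -> (forall E, trans p None E -> Exp E (stay n) <= b) ->
  stay n.+1 p <= b.
Proof.
move=> b0 h; apply: ge_sup; first by exists 0; left.
by move=> _ [->//|[E pE ->]]; exact: h.
Qed.

Lemma stay_noninc n p : stay n.+1 p <= stay n p.
Proof.
elim: n p => [|n IH] p; first by case/andP: (stay_bdd 1 p).
apply: stay_le; first by case/andP: (stay_bdd n.+1 p).
move=> E pE; apply: le_trans (stay_step n pE).
apply: (le_Exp (stay_bdd n)) => [s|s _]; last exact: IH.
by case/andP: (stay_bdd n.+1 s).
Qed.

Lemma stay_noninc_le m n p : (m <= n)%N -> stay n p <= stay m p.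
Proof.
move=> /subnK <-; elim: (n - m)%N => [//|k IH]; rewrite addSn.
exact: le_trans (stay_noninc _ _) IH.
Qed.

Lemma stay_lim p : X p -> inf (range (stay^~ p)) = 0.
Proof.
move: p; pose m p := inf (range (stay^~ p)).
have mc : bdd 1 m.
  move=> p; have := range_inf p stay_bdd 0; have := stay_bdd 0 p; rewrite /m.
  lra.
apply: (@no_drift m 1) => // p Xp b b0 Eb; rewrite leNgt; apply/negP => bm.
pose b' := (b + m p) / 2.
have /choice[N NP] : forall E, exists n, trans p None E -> Exp E (stay n) <= b'.
  move=> E; have [pE|] := pselect (trans p None E); last by exists 0%N.
  apply: contrapT => h.
  have : b' <= Exp E m.
    apply: (Exp_inf stay_bdd stay_noninc) => n.
    rewrite leNgt; apply/negP => /ltW le; apply: h; exists n => _; exact: le.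
  by have := Eb E pE; rewrite /b'; lra.
have [M _ Mmax] : exists2 x, (0%N |` (N @` [set E | trans p None E])) x &
    forall y, (0%N |` (N @` [set E | trans p None E])) y -> (y <= x)%O.
  apply: finite_max; last by exists 0%N; left.
  rewrite finite_setU; split => //.
  exact/finite_image/reach_finite_tau.
have : stay M.+1 p <= b'.
  apply: stay_le; first by rewrite /b'; have := mc p; lra.
  move=> E pE; apply: le_trans (NP E pE).
  apply: (le_Exp (stay_bdd _)) => [s|s _]; first by case/andP: (stay_bdd M s).
  by apply: stay_noninc_le; apply: Mmax; right; exists E.
by have := range_inf p stay_bdd M.+1; rewrite -/(m p) /b'; lra.
Qed.

Lemma ltrans_supp a (D E : subdist R P) : ltrans a D E -> supp D `<=` X -> supp E `<=` X.
Proof.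
move=> DE; apply: lifting_supp DE => s F Xs sF; exact: reach_trans Xs sF.
Qed.

Lemma ltrans_mass a (D E : subdist R P) : ltrans a D E -> Exp D (fun=> 1) <= Exp E (fun=> 1) :> R.
Proof.
move=> DE; apply: (lifting_Exp_ge (X := setT) (@bdd1 _ _) (@bdd1 _ _) _ DE) => //.
by move=> s F _ /trans_dist/dist1 ->.
Qed.

Lemma Exp_split (D D1 D2 : subdist R P) f c :
  (forall s, D s = D1 s + D2 s) -> bdd c f -> Exp D f = Exp D1 f + Exp D2 f.
Proof.
move=> DE fc; apply: EFin_inj; rewrite EFinD !(Exp_EFin _ fc).
rewrite -esumD.
- by apply: eq_esum => s _; rewrite DE mulrDl EFinD.
- by move=> s _; rewrite lee_fin mulr_ge0 ?weight_ge0//; case/andP: (fc s).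
- by move=> s _; rewrite lee_fin mulr_ge0 ?weight_ge0//; case/andP: (fc s).
Qed.

Section Hyper.
Variables (D D' : subdist R P) (Ds Dto Dx : nat -> subdist R P).
Hypothesis DX : supp D `<=` X.
Hypothesis Dsplit : forall k s, Ds k s = Dto k s + Dx k s.
Hypothesis D_0 : D = Ds 0%N.
Hypothesis Dstep : forall k, ltrans None (Dto k) (Ds k.+1).
Hypothesis D'E : forall s, ((D' s)%:E = \esum_(k in [set: nat]) (Dx k s)%:E)%E.

Lemma run_supp k : supp (Ds k) `<=` X.
Proof.
elim: k => [|k IH]; first by rewrite -D_0.
apply: ltrans_supp (Dstep k) _ => s; rewrite /supp /= => Dtos; apply: IH.
by rewrite /supp /= Dsplit (lt_le_trans Dtos)// lerDl weight_ge0.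
Qed.

Lemma run_to_supp k : supp (Dto k) `<=` X.
Proof.
move=> s; rewrite /supp /= => Dtos; apply: (@run_supp k).
by rewrite /supp /= Dsplit (lt_le_trans Dtos)// lerDl weight_ge0.
Qed.

Lemma run_limit_supp : supp D' `<=` X.
Proof.
move=> s; rewrite /supp /= -lte_fin D'E => s0.
have [k Dxk] : exists k, 0 < Dx k s.
  apply: contrapT => h; move: s0; rewrite esum1 ?ltxx// => k _.
  by rewrite suppP// => Dxk; apply: h; exists k.
apply: (@run_supp k); rewrite /supp /= Dsplit (lt_le_trans Dxk)//.
by rewrite lerDr weight_ge0.
Qed.

Lemma run_stay k j : Exp (Ds k) (stay j) <= Exp D (stay (j + k)).
Proof.
elim: k j => [|k IH] j; first by rewrite addn0 D_0.
rewrite addnS -addSn; apply: le_trans (IH j.+1).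
apply: (@le_trans _ _ (Exp (Dto k) (stay j.+1))).
  apply: (lifting_Exp_le (X := setT) (Y := setT) (stay_bdd _) (stay_bdd _) _ (Dstep k)) => //.
    by move=> s E _ _ _; exact: stay_step.
  exact: ltrans_mass (Dstep k).
rewrite (Exp_split (Dsplit k) (stay_bdd _)) lerDl Exp_ge0// => s.
by case/andP: (stay_bdd j.+1 s).
Qed.

Lemma run_Exp y c : 0 < c -> bdd c y ->
  (forall p E, X p -> trans p None E -> y p <= Exp E y) -> Exp D y <= Exp D' y.
Proof.
move=> c0 yc ystep.
have y0 s : 0 <= y s by case/andP: (yc s).
have sumx n : Exp D y <= \sum_(k < n) Exp (Dx k) y + Exp (Ds n) y.
  elim: n => [|n IH]; first by rewrite big_ord0 add0r D_0.
  rewrite big_ord_recr/=; have := Exp_split (Dsplit n) yc.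
  have : Exp (Dto n) y <= Exp (Ds n.+1) y.
    by apply: (lifting_Exp_ge (X := X) yc yc _ (Dstep n) (@run_to_supp n)).
  lra.
have sumle n : \sum_(k < n) Exp (Dx k) y <= Exp D' y.
  have -> : Exp D' y = fine (\esum_(k in [set: nat]) (1 * Exp (Dx k) y)%:E)%E.
    rewrite -(@Exp_mix _ _ _ (fun=> 1) Dx D' _ c)//.
    by move=> s; rewrite D'E; apply: eq_esum => k _; rewrite mul1r.
  rewrite -lee_fin fineK; last first.
    rewrite -(@Exp_mix _ _ _ (fun=> 1) Dx D' _ c)//.
    by move=> s; rewrite D'E; apply: eq_esum => k _; rewrite mul1r.
  apply: esum_ge; exists `I_n; first by split.
  rewrite -fsbig_ord sumEFin lee_fin.
  by under [leRHS]eq_bigr do rewrite mul1r.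
have tail n : Exp (Ds n) y <= c * Exp D (stay n).
  apply: (@le_trans _ _ (c * Exp (Ds n) (stay 0))).
    rewrite -(ExpZ _ (ltW c0) (fun s => proj1 (andP (stay_bdd 0 s)))).
    apply: (@le_Exp _ _ _ _ _ c) => // s; rewrite /= mulr1 ?lexx ?(ltW c0)//.
    by move=> _; case/andP: (yc s).
  by rewrite ler_pM2l//; exact: (run_stay n 0).
rewrite leNgt; apply/negP => gap.
have : (Exp D y - Exp D' y) / c <= Exp D (fun p => inf (range (stay^~ p))).
  apply: (Exp_inf stay_bdd stay_noninc) => n.
  by rewrite ler_pdivrMr// mulrC; have := sumx n; have := sumle n; have := tail n; lra.
have -> : Exp D (fun p => inf (range (stay^~ p))) = Exp D (fun=> 0).
  by apply: eq_Exp => s /DX; exact: stay_lim.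
rewrite Exp_cst// mul0r ler_pdivrMr// mul0r; lra.
Qed.

End Hyper.

Lemma hyper_Exp (D D' : subdist R P) y c : supp D `<=` X -> hyper D D' -> 0 < c -> bdd c y ->
  (forall p E, X p -> trans p None E -> y p <= Exp E y) -> Exp D y <= Exp D' y.
Proof.
move=> DX [Ds [Dto [Dx [h1 h2 h3 h4]]]].
exact: (run_Exp DX h1 h2 h3 h4).
Qed.

Lemma hyper_supp (D D' : subdist R P) : supp D `<=` X -> hyper D D' -> supp D' `<=` X.
Proof.
move=> DX [Ds [Dto [Dx [h1 h2 h3 h4]]]].
exact: (run_limit_supp DX h1 h2 h3 h4).
Qed.

Lemma hyper_dist (D D' : subdist R P) : supp D `<=` X -> hyper D D' -> is_dist D -> is_dist D'.
Proof.
move=> DX DD' /dist1 D1; apply/dist1/eqP; rewrite eq_le Exp_le_cst//=.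
rewrite -[leLHS]D1; apply: (hyper_Exp DX DD' ltr01 (@bdd1 _ _)).
by move=> p E _ /trans_dist/dist1 ->.
Qed.

Lemma ltrans_dist a (D E : subdist R P) : ltrans a D E -> is_dist D -> is_dist E.
Proof.
move=> DE /dist1 D1; apply/dist1/eqP; rewrite eq_le Exp_le_cst//= -[leLHS]D1.
exact: ltrans_mass DE.
Qed.

End Convergence.

Section WeakMoves.
Variables (R : realType) (L : Type) (P : pLTS R L).
Implicit Types D E : subdist R P.

Lemma hyper_refl D : hyper D D.
Proof.
exists (fun k => if k is _.+1 then zerod R P else D), (fun=> zerod R P),
  (fun k => if k is _.+1 then zerod R P else D); split=> //.
- by move=> [|k] s /=; rewrite add0r.
- by move=> k; exact: lifting0.
- move=> s; rewrite (eq_esum (b := fun k => if k \in [set 0%N] then (D s)%:E else 0%E)).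
    by rewrite -esum_mkcond esum_set1// lee_fin weight_ge0.
  by move=> [|k] _ /=; [rewrite mem_set|rewrite memNset].
Qed.

Lemma hyper_step D E : ltrans None D E -> hyper D E.
Proof.
move=> DE; exists (fun k => match k with 0 => D | 1 => E | _ => zerod R P end),
  (fun k => if k is _.+1 then zerod R P else D),
  (fun k => if k is 1 then E else zerod R P); split=> //.
- by move=> [|[|k]] s /=; rewrite ?addr0 ?add0r.
- by move=> [|[|k]] //=; exact: lifting0.
- move=> s; rewrite (eq_esum (b := fun k => if k \in [set 1%N] then (E s)%:E else 0%E)).
    by rewrite -esum_mkcond esum_set1// lee_fin weight_ge0.
  by move=> [|[|k]] _ /=; [rewrite memNset|rewrite mem_set|rewrite memNset].
Qed.

Lemma wtrans_step p a E : trans p a E -> wtrans a (pdist R p) E.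
Proof.
case: a => [a|] pE /=; last exact/hyper_step/lifting_point.
exists (pdist R p), E; split; [exact: hyper_refl|exact: lifting_point|exact: hyper_refl].
Qed.

End WeakMoves.

(** * Bellman operators and failure simulation *)

Section Bellman.
Variables (R : realType) (Om : choiceType) (C : pLTS R Om).
Implicit Types (k : Om -> R) (y : C -> R) (x : C).

(* Having the deadlock payoff among the options keeps the infimum in [bell] from
   ever being taken over the empty set. *)
Inductive option_value k y x : R -> Prop :=
| Succeed w : enabled x (Some w) -> option_value k y x (k w)
| Deadlock : (forall a, ~ enabled x a) -> option_value k y x 1
| Step E : (forall w, ~ enabled x (Some w)) -> trans x None E ->
    option_value k y x (Exp E y).

Definition bell k y x : R := inf (option_value k y x).

Lemma option_value_bdd k y x z : bdd 2 k -> bdd 2 y ->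
  option_value k y x z -> 0 <= z <= 2.
Proof. by move=> k2 y2 [w _|_|E _ _]; [exact: k2|lra|exact: bdd_Exp]. Qed.

Lemma option_value_ex k y x : option_value k y x !=set0.
Proof.
have [[w xw]|nw] := pselect (exists w, enabled x (Some w)).
  by exists (k w); exact: Succeed.
have [[E xE]|nE] := pselect (enabled x None).
  by exists (Exp E y); apply: Step xE => w xw; apply: nw; exists w.
exists 1; apply: Deadlock => -[w|] //.
by move=> xw; apply: nw; exists w.
Qed.

Lemma bell_le k y x z : bdd 2 k -> bdd 2 y ->
  option_value k y x z -> bell k y x <= z.
Proof.
move=> k2 y2 oz; apply: ge_inf => //; exists 0 => z' /(option_value_bdd k2 y2).
by case/andP.
Qed.

Lemma le_bell k y x a : (forall z, option_value k y x z -> a <= z) ->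
  a <= bell k y x.
Proof. by move=> h; apply: lb_le_inf => //; exact: option_value_ex. Qed.

Lemma bell_bdd k y : bdd 2 k -> bdd 2 y -> bdd 2 (bell k y).
Proof.
move=> k2 y2 x; apply/andP; split.
  by apply: le_bell => z /(option_value_bdd k2 y2)/andP[].
have [z oz] := option_value_ex k y x.
apply: le_trans (bell_le k2 y2 oz) _.
by case/andP: (option_value_bdd k2 y2 oz).
Qed.

Lemma le_bell2 k k' y y' x : bdd 2 k -> bdd 2 y -> bdd 2 y' ->
  (forall w, k w <= k' w) -> (forall x, y x <= y' x) ->
  bell k y x <= bell k' y' x.
Proof.
move=> k2 y2 y'2 kk yy; apply: le_bell => _ [w xw|dl|E ns xE].
- exact: le_trans (bell_le k2 y2 (Succeed _ _ xw)) _.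
- exact: (bell_le k2 y2 (Deadlock _ _ dl)).
- apply: le_trans (bell_le k2 y2 (Step _ _ ns xE)) _.
  by apply: (le_Exp y'2) => // s; case/andP: (y2 s).
Qed.

End Bellman.

Section Parallel.
Variables (R : realType) (Act : Type) (Om : choiceType).
Variables (T : pLTS R (Act + Om)) (P : pLTS R Act).

Lemma par_succ (t : T) (p : P) w :
  enabled (P := par T P) (t, p) (Some w) <-> enabled t (Some (inr w)).
Proof.
split=> [[E tE]|[D tD]]; last first.
  by exists (prodd D (pdist R p)); exact: (@par_test _ _ _ T P t p (Some w)).
have : forall x w' E, par_trans x w' E -> x = (t, p) -> w' = Some w ->
    enabled t (Some (inr w)).
  by move=> _ _ _ [t' p' w' D tD [<- _] ww|//|//]; exists D; rewrite ww in tD.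
by move=> /(_ _ _ _ tE); apply.
Qed.

Lemma par_tauP (t : T) (p : P) E : trans (p := par T P) (t, p) None E ->
  [\/ exists2 Th, trans t None Th & E = prodd Th (pdist R p),
      exists2 G, trans p None G & E = prodd (pdist R t) G |
      exists a Th G, [/\ trans t (Some (inl a)) Th, trans p (Some a) G &
        E = prodd Th G]].
Proof.
move=> tpE; have : forall x w' E, par_trans x w' E -> x = (t, p) -> w' = None ->
    [\/ exists2 Th, trans t None Th & E = prodd Th (pdist R p),
      exists2 G, trans p None G & E = prodd (pdist R t) G |
      exists a Th G, [/\ trans t (Some (inl a)) Th, trans p (Some a) G &
        E = prodd Th G]].
  move=> _ _ _ [t' p' w' D tD|t' p' G pG|t' p' a D G tD pG] [tt pp] ww.
  - rewrite ww /= in tD; rewrite -tt -pp; constructor 1; by exists D.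
  - rewrite -tt -pp; constructor 2; by exists G; rewrite -?pp.
  - rewrite -tt -pp; constructor 3; by exists a, D, G.
by move=> /(_ _ _ _ tpE); apply.
Qed.

Lemma Exp_prod_pdistl (t : T) (E : subdist R P) (y : T * P -> R) c :
  0 <= c -> bdd c y ->
  Exp (prodd (pdist R t) E) y = Exp E (fun p => y (t, p)).
Proof.
move=> c0 yc; rewrite (Exp_prodd _ _ c0 yc) Exp_pdist// => t'.
by apply: Exp_ge0 => s; case/andP: (yc (t', s)).
Qed.

Lemma Exp_prod_pdistr (p : P) (Th : subdist R T) (y : T * P -> R) c :
  0 <= c -> bdd c y ->
  Exp (prodd Th (pdist R p)) y = Exp Th (fun t => y (t, p)).
Proof.
move=> c0 yc; rewrite (Exp_prodd _ _ c0 yc); apply: eq_Exp => t _.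
by rewrite Exp_pdist// => p'; case/andP: (yc (t, p')).
Qed.

Hypothesis T_tests : is_test_pLTS T.

Lemma par_succ_uniq (x : par T P) w w' :
  enabled x (Some w) -> enabled x (Some w') -> w = w'.
Proof. by case: x => t p /par_succ tw /par_succ; exact: T_tests.1. Qed.

Lemma supp_prodd (S S' : choiceType) (D : subdist R S) (E : subdist R S') x :
  supp (prodd D E) x -> supp D x.1 /\ supp E x.2.
Proof.
rewrite /supp /= => DE; have D0 := weight_ge0 D x.1; have E0 := weight_ge0 E x.2.
by split; rewrite lt_neqAle eq_sym ?D0 ?E0 andbT; apply/eqP => h;
  move: DE; rewrite h ?mul0r ?mulr0 ltxx.
Qed.

Lemma par_succ_step (x : par T P) w E y :
  enabled x (Some w) -> trans x None E -> supp E y -> enabled y (Some w).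
Proof.
case: x => t p /par_succ tw; case: y => t' p' xE Ey; apply/par_succ.
case: (par_tauP xE) => [[Th tTh EE]|[G pG EE]|[a [Th [G [tTh pG EE]]]]];
  move: Ey; rewrite EE => /supp_prodd[/= t's _].
- exact: (T_tests.2 t w None Th tw tTh).
- by move/supp_pdist: t's => ->.
- exact: (T_tests.2 t w (Some a) Th tw tTh).
Qed.

End Parallel.

Section FailureSimulation.
Variables (R : realType) (Act : Type) (Om : choiceType).
Variables (T : pLTS R (Act + Om)) (P : pLTS R Act).
Hypothesis T_tests : is_test_pLTS T.
Variables (Delta Gamma : subdist R P).
Hypotheses (Delta_fin : finitary Delta) (Gamma_fin : finitary Gamma).
Hypotheses (Delta_conv : convergent Delta) (Gamma_conv : convergent Gamma).

Local Notation XD := [set p | reachable Delta p].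
Local Notation XG := [set p | reachable Gamma p].
Local Notation FS := (@failure_sim R Act P).
Local Notation C := (par T P).

Definition simulated (p : P) (D : subdist R P) :=
  [/\ XG p, FS p D, supp D `<=` XD & is_dist D].

Lemma simulated_step p D a E : simulated p D -> trans p a E ->
  exists D', [/\ wtrans a D D', lifting FS E D', supp D' `<=` XD & is_dist D'].
Proof.
move=> [_ [Q [Qsim QpD]] DX D1] pE.
have [/(_ a E (wtrans_step pE))[D' [DD' ED']] _] := Qsim p D QpD.
exists D'; split => //; first by apply: lifting_mono ED' => s F sF; exists Q.
- case: a pE DD' => [a|] _ /=; last exact: hyper_supp.
  move=> [D2 [D3 [h1 h2 h3]]]; apply: hyper_supp h3.
  by apply: ltrans_supp h2 _; exact: hyper_supp h1.
- case: a pE DD' => [a|] _ /=; last first.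
    by move=> DD'; exact: (hyper_dist Delta_fin Delta_conv DX DD').
  move=> [D2 [D3 [h1 h2 h3]]].
  have D2X := hyper_supp DX h1.
  apply: (hyper_dist Delta_fin Delta_conv (ltrans_supp h2 D2X) h3).
  exact/(ltrans_dist h2)/(hyper_dist Delta_fin Delta_conv DX h1).
Qed.

Lemma simulated_refuses p D A : simulated p D -> refuses A (pdist R p) -> wrefuses A D.
Proof.
move=> [_ [Q [Qsim QpD]] _ _] pA; have [_] := Qsim p D QpD; apply.
by exists (pdist R p); split => //; exact: hyper_refl.
Qed.

Lemma lift_simulated E D' f g c c' : bdd c f -> bdd c' g ->
  (forall p D, simulated p D -> Exp D g <= f p) ->
  is_dist E -> supp E `<=` XG -> lifting FS E D' -> supp D' `<=` XD ->
  is_dist D' -> Exp D' g <= Exp E f.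
Proof.
move=> fc gc fg /dist1 E1 EX ED' D'X /dist1 D'1.
apply: (lifting_Exp_le fc gc _ ED' EX D'X); last by rewrite E1 D'1.
by move=> s F Xs FX F1 sF; exact: fg.
Qed.

Lemma hyper_par k (y : C -> R) t D D' : bdd 2 k -> bdd 2 y ->
  (forall x, y x <= bell k y x) -> (forall w, ~ enabled t (Some (inr w))) ->
  supp D `<=` XD -> hyper D D' ->
  Exp D (fun p => y (t, p)) <= Exp D' (fun p => y (t, p)).
Proof.
move=> k2 y2 yb nt DX DD'.
apply: (hyper_Exp Delta_fin Delta_conv DX DD' (c := 2)) => //.
move=> p E _ pE; rewrite -(Exp_prod_pdistl _ _ _ y2)//.
apply: le_trans (yb _) _; apply: bell_le => //; apply: Step; last exact: par_proc.
by move=> w /par_succ; exact: nt.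
Qed.

Section Dominated.
Variables (k : Om -> R) (y U : C -> R).
Hypotheses (k2 : bdd 2 k) (y2 : bdd 2 y) (U2 : bdd 2 U).
Hypothesis y_bell : forall x, y x <= bell k y x.
Hypothesis y_le : forall t p D, simulated p D -> Exp D (fun p' => y (t, p')) <= U (t, p).
Hypothesis U_succ : forall t p w, enabled t (Some (inr w)) -> k w <= U (t, p).

Lemma Exp_hyper_lift D D' E t : supp D `<=` XD -> hyper D D' ->
  is_dist E -> supp E `<=` XG -> lifting FS E D' -> supp D' `<=` XD ->
  is_dist D' -> Exp D (fun p => y (t, p)) <= Exp E (fun p => U (t, p)).
Proof.
move=> DX DD' E1 EX ED' D'X D'1.
have [[w tw]|nt] := pselect (exists w, enabled t (Some (inr w))).
  apply: (@le_trans _ _ (k w)).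
    apply: Exp_le_cst => [|p|p _]; first by case/andP: (k2 w).
      by case/andP: (y2 (t, p)).
    apply: le_trans (y_bell _) _; apply: bell_le => //.
    by apply: Succeed; exact/par_succ.
  rewrite -[leLHS](Exp_dist E1); last by case/andP: (k2 w).
  apply: (@le_Exp _ _ _ _ _ 2) => [p|p|p _]; first exact: U2.
    by case/andP: (k2 w).
  exact: U_succ.
apply: le_trans (hyper_par k2 y2 y_bell _ DX DD') _.
  by move=> w tw; apply: nt; exists w.
apply: (@lift_simulated _ _ _ _ 2 2) => //.
by move=> p F; exact: y_le.
Qed.

Lemma simulated_option (N M : C -> R) (b c : R) p D t z :
  bdd 2 N -> bdd c M -> 0 <= b ->
  (forall x, N x <= bell k N x) -> (forall x, N x <= bell k y x) ->
  (forall t p D, simulated p D -> Exp D (fun p' => N (t, p')) <= M (t, p)) ->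
  (forall E, trans p None E ->
     Exp E (fun p' => M (t, p')) <= Exp E (fun p' => U (t, p')) + b) ->
  simulated p D -> option_value k U (t, p) z -> Exp D (fun p' => N (t, p')) <= z + b.
Proof.
move=> N2 Mc b0 NN Ny NM Mb pD oz.
have [XGp pFD DX D1] := pD.
case: oz => [w xw|dl|E ns xE].
- apply: (@le_trans _ _ (k w)); last by rewrite lerDl.
  apply: Exp_le_cst => [|q|q _]; first by case/andP: (k2 w).
    by case/andP: (N2 (t, q)).
  apply: le_trans (NN _) _; apply: bell_le => //.
  by move/par_succ: xw => tw; apply: Succeed; exact/par_succ.
- have nt w : ~ enabled t (Some (inr w)).
    by move=> tw; apply: (dl (Some w)); exact/par_succ.
  have ntau : ~ enabled t None.
    by move=> [Th tTh]; apply: (dl None); exists (prodd Th (pdist R p)); exact: (@par_test _ _ _ T P t p None).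
  pose A := [set a | enabled t (Some (inl a))].
  have pA : refuses A (pdist R p).
    move=> q /supp_pdist ->; split.
      by move=> [E pE]; apply: (dl None); exists (prodd (pdist R t) E); exact: par_proc.
    move=> a [Th tTh] [E pE]; apply: (dl None); exists (prodd Th E).
    exact: par_sync tTh pE.
  have [Dp [DDp Dpr]] := simulated_refuses pD pA.
  apply: (@le_trans _ _ 1); last by rewrite lerDl.
  apply: le_trans (hyper_par k2 N2 NN nt DX DDp) _.
  apply: Exp_le_cst => // q; first by case/andP: (N2 (t, q)).
  move=> /Dpr[qtau qA]; apply: le_trans (NN _) _; apply: bell_le => //.
  apply: Deadlock => -[w|]; first by move/par_succ; exact: nt.
  move=> [F /par_tauP[[Th tTh _]|[G qG _]|[a [Th [G [tTh qG _]]]]]].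
  + by apply: ntau; exists Th.
  + by apply: qtau; exists G.
  + by apply: (qA a); [exists Th|exists G].
have nt w : ~ enabled t (Some (inr w)) by move/(par_succ t p); exact: ns.
have ns' q w : ~ enabled (P := C) (t, q) (Some w) by move/par_succ; exact: nt.
case: (par_tauP xE) => [[Th tTh ->]|[G pG ->]|[a [Th [G [tTh pG ->]]]]].
- apply: (@le_trans _ _ (Exp (prodd Th (pdist R p)) U)); last by rewrite lerDl.
  rewrite (Exp_prod_pdistr _ _ _ U2)//.
  apply: (@le_trans _ _ (Exp D (fun q => Exp Th (fun t' => y (t', q))))).
    apply: (@le_Exp _ _ _ _ _ 2) => [q|q|q _].
    + by apply: bdd_Exp => // t'; exact: y2.
    + by case/andP: (N2 (t, q)).
    + apply: le_trans (Ny _) _; rewrite -(Exp_prod_pdistr _ _ _ y2)//.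
      apply: bell_le => //; apply: Step; first exact: ns'.
      exact: (@par_test _ _ _ T P t q None).
  rewrite (@Exp_swap _ _ _ _ _ _ 2)//; last by move=> q t'; exact: y2.
  apply: (@le_Exp _ _ _ _ _ 2) => [t'|t'|t' _].
  + exact: U2.
  + by apply: Exp_ge0 => q; case/andP: (y2 (t', q)).
  + exact: y_le.
- rewrite (Exp_prod_pdistl _ _ _ U2)//; apply: le_trans (Mb _ pG).
  have [D' [DD' GD' D'X D'1]] := simulated_step pD pG.
  apply: le_trans (hyper_par k2 N2 NN nt DX DD') _.
  apply: (@lift_simulated _ _ _ _ c 2) => //.
  + by move=> q F; exact: NM.
  + exact: trans_dist pG.
  + exact: reach_trans XGp pG.
- apply: (@le_trans _ _ (Exp (prodd Th G) U)); last by rewrite lerDl.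
  rewrite (Exp_prodd _ _ _ U2)//.
  have [D' [/= [D2 [D3 [h1 h2 h3]]] GD' D'X D'1]] := simulated_step pD pG.
  have D2X := hyper_supp DX h1; have D3X := ltrans_supp h2 D2X.
  apply: le_trans (hyper_par k2 N2 NN nt DX h1) _.
  apply: (@le_trans _ _ (Exp D3 (fun q => Exp Th (fun t' => y (t', q))))).
    apply: (lifting_Exp_ge (X := setT) (c := 2) (c' := 2) _ _ _ h2) => //.
      by move=> q; apply: bdd_Exp => // t'; exact: y2.
    move=> q F _ qF; apply: le_trans (Ny _) _.
    rewrite (@Exp_swap _ _ _ _ _ (fun q t' => y (t', q)) 2)//; last by move=> ? ?; exact: y2.
    rewrite -(Exp_prodd _ _ _ y2)//.
    by apply: bell_le => //; apply: Step; [exact: ns'|exact: par_sync tTh qF].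
  rewrite (@Exp_swap _ _ _ _ _ _ 2)//; last by move=> q t'; exact: y2.
  apply: (@le_Exp _ _ _ _ _ 2) => [t'|t'|t' _].
  + by apply: bdd_Exp => // q; exact: U2.
  + by apply: Exp_ge0 => q; case/andP: (y2 (t', q)).
  + apply: (Exp_hyper_lift _ D3X h3) => //; first exact: trans_dist pG.
    exact: reach_trans XGp pG.
Qed.

End Dominated.

Definition dominated (U y : C -> R) :=
  [/\ forall x, 1 <= y x <= 2, forall x, y x <= bell (fun=> 2) y x &
      forall t p D, simulated p D -> Exp D (fun p' => y (t, p')) <= U (t, p)].

Lemma two_bdd (S : Type) : bdd 2 (fun=> 2 : R) (S := S).
Proof. by move=> s; lra. Qed.
Local Notation two := (@two_bdd Om).

Section DominatedFixpoint.
Variable U : C -> R.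
Hypothesis U12 : forall x, 1 <= U x <= 2.
Hypothesis U_bell : forall x, bell (fun=> 2) U x <= U x.

Let U2 : bdd 2 U. Proof. by move=> x; have := U12 x; lra. Qed.

Lemma prefixed_succ t p w : enabled t (Some (inr w)) -> 2 <= U (t, p).
Proof.
move=> tw; apply: le_trans (U_bell _); apply: le_bell => _ [w' _//|dl|E ns _].
  by case: (dl (Some w)); exact/par_succ.
by case: (ns w); exact/par_succ.
Qed.

(* [m p] below is the worst excess over [U] at [p]; only internal moves of [p] fail
   to remove it, and they hand it on to the successors of [p]. *)
Lemma dominated_bell y : dominated U y -> dominated U (bell (fun=> 2) y).
Proof.
move=> [y12 yb yU].
have y2 : bdd 2 y by move=> x; have := y12 x; lra.
pose N := bell (fun=> 2) y; have N2 : bdd 2 N := bell_bdd two y2.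
have NN x : N x <= bell (fun=> 2) N x by exact: (le_bell2 _ two y2 N2 (fun=> lexx _) yb).
have N12 x : 1 <= N x <= 2.
  by have := yb x; have := y12 x; have := N2 x; rewrite -/N; rewrite /N; lra.
split=> // t0 p0 D0 pD0.
pose m p := sup [set z | z = 0 \/ exists t D,
  simulated p D /\ z = Exp D (fun p' => N (t, p')) - U (t, p)].
have Eub p z : (z = 0 \/ exists t D,
    simulated p D /\ z = Exp D (fun p' => N (t, p')) - U (t, p)) -> z <= 2.
  move=> [->//|[t [D [_ ->]]]].
  have : 0 <= Exp D (fun p' => N (t, p')) <= 2 by apply: bdd_Exp => // q; exact: N2.
  by have := U12 (t, p); lra.
have m2 : bdd 2 m.
  move=> p; apply/andP; split; first by apply: ub_le_sup; [exists 2 => z /Eub|left].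
  by apply: ge_sup; [exists 0; left|move=> z /Eub].
have mE t p D : simulated p D -> Exp D (fun p' => N (t, p')) - U (t, p) <= m p.
  by move=> pD; apply: ub_le_sup; [exists 2 => z /Eub|right; exists t, D].
suff m0 : m p0 = 0 by have := mE t0 _ _ pD0; rewrite m0 subr_le0.
have [Xp0 _ _ _] := pD0.
apply: (no_drift Gamma_fin Gamma_conv _ m2) => // p Xp b b0 Eb.
apply: ge_sup; first by exists 0; left.
move=> z [->//|[t [D [pD ->]]]].
suff : Exp D (fun p' => N (t, p')) - b <= bell (fun=> 2) U (t, p).
  by have := U_bell (t, p); lra.
apply: le_bell => z' oz'; rewrite lerBlDr.
apply: (@simulated_option (fun=> 2) y U two y2 U2 yb yU _ N (fun x => U x + m x.2) b 4 p D t z') => //.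
- by move=> *; apply: prefixed_succ; eassumption.
- by move=> x; have := U12 x; have := m2 x.2; lra.
- by move=> t' p' D' /(mE t')/=; lra.
- move=> E pE /=.
  rewrite (@ExpD _ _ E (fun p' => U (t, p')) m 2 2 (fun p' => U2 (t, p')) m2).
  by rewrite lerD2l; exact: Eb.
Qed.

Lemma dominated_fixpoint : exists y, dominated U y /\ forall x, bell (fun=> 2) y x = y x.
Proof.
pose W := {y : C -> R | dominated U y}.
pose le (a b : W) : bool := `[< forall x, sval a x <= sval b x >].
have W0 : dominated U (fun=> 1).
  split=> [x|x|t p D pD].
  - lra.
  - apply: le_bell => _ [w _|_//|E _ /trans_dist E1]; first by lra.
    by rewrite Exp_dist.
  - apply: le_trans (_ : 1 <= _); last by case/andP: (U12 (t, p)).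
    exact: Exp_le_cst.
have := @Zorn W le; case.
- by move=> a; apply/asboolP => x.
- move=> a b c /asboolP ab /asboolP bc; apply/asboolP => x.
  exact: le_trans (ab x) (bc x).
- move=> [a da] [b db] /asboolP/= ab /asboolP/= ba.
  have e : a = b by apply/funext => x; apply/eqP; rewrite eq_le ab ba.
  by subst b; congr exist; exact: Prop_irrelevance.
- move=> A totA; have [[a0 Aa0]|nA] := pselect (A !=set0); last first.
    by exists (exist _ _ W0) => s As; case: nA; exists s.
  pose B := (@sval _ (dominated U)) @` A.
  have B0 : B !=set0 by exists (sval a0), a0.
  have B12 f x : B f -> 1 <= f x <= 2 by move=> [a _ <-]; case: (svalP a) => a1 _ _; exact: a1.
  have Bb f : B f -> bdd 2 f by move=> Bf x; have := B12 f x Bf; lra.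
  have Btot f g : B f -> B g -> (forall s, f s <= g s) \/ (forall s, g s <= f s).
    move=> [a Aa <-] [b Ab <-]; have [|] : le a b \/ le b a by exact: totA.
      by move=> /asboolP ?; left.
    by move=> /asboolP ?; right.
  pose s x := sup [set f x | f in B].
  have Bs f x : B f -> f x <= s x.
    move=> Bf; apply: ub_le_sup; last by exists f.
    by exists 2 => _ [g Bg <-]; case/andP: (Bb g Bg x).
  have s12 x : 1 <= s x <= 2.
    apply/andP; split.
      have [f Bf] := B0; apply: le_trans (Bs f x Bf).
      by case/andP: (B12 f x Bf).
    apply: ge_sup; first by have [f Bf] := B0; exists (f x), f.
    by move=> _ [g Bg <-]; case/andP: (B12 g x Bg).
  have s2 : bdd 2 s by move=> x; have := s12 x; lra.
  have ds : dominated U s.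
    split=> // [x|t p D pD].
      apply: ge_sup; first by have [f Bf] := B0; exists (f x), f.
      move=> _ [f Bf <-]; apply: (@le_trans _ _ (bell (fun=> 2) f x)).
        by case: Bf => a _ <-; case: (svalP a) => _ ab _; exact: ab.
      apply: (le_bell2 _ two (Bb _ Bf) s2 (fun=> lexx _)) => x'; exact: Bs.
    have -> : (fun p' => s (t, p')) =
        (fun p' => sup [set f p' | f in (fun f p' => f (t, p')) @` B]).
      by apply/funext => p'; rewrite image_comp.
    apply: (@Exp_sup_chain _ _ _ _ 2).
    + by move=> _ [f Bf <-] p'; exact: Bb.
    + by have [f Bf] := B0; exists (fun p' => f (t, p')), f.
    + move=> _ _ [f Bf <-] [g Bg <-].
      by have [fg|gf] := Btot f g Bf Bg; [left|right] => p'.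
    + by move=> _ [f [a Aa <-] <-]; case: (svalP a) => _ _; exact.
  exists (exist _ s ds) => a Aa; apply/asboolP => x /=.
  by apply: Bs; exists a.
move=> [y dy] ymax; exists y; split=> // x.
have /(congr1 sval)/= -> // : exist _ _ (dominated_bell dy) = exist _ y dy :> W.
by apply: ymax; apply/asboolP => x' /=; have [_ yb _] := dy.
Qed.

End DominatedFixpoint.

Section Values.
Variables (k : Om -> R) (y : C -> R) (U : nat -> C -> R).
Hypothesis k2 : bdd 2 k.
Hypothesis y12 : forall x, 1 <= y x <= 2.
Hypothesis y_fix : forall x, bell (fun=> 2) y x = y x.

Fixpoint value n : C -> R := if n is n'.+1 then bell k (value n') else y.

Lemma value_bdd n : bdd 2 (value n).
Proof.
elim: n => [|n IH]; last exact: bell_bdd.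
by move=> x; have := y12 x; rewrite /=; lra.
Qed.

Lemma value_noninc n x : value n.+1 x <= value n x.
Proof.
elim: n x => [|n IH] x.
  rewrite [leRHS]/= -y_fix.
  by apply: (le_bell2 _ k2 (value_bdd 0) (value_bdd 0)) => // w; case/andP: (k2 w).
exact: (le_bell2 _ k2 (value_bdd _) (value_bdd _) (fun=> lexx _) IH).
Qed.

Definition value_lim x := inf (range (value^~ x)).

Lemma value_lim_bdd : bdd 2 value_lim.
Proof.
move=> x; have := range_inf x value_bdd 0; have := value_bdd 0 x.
by rewrite -/(value_lim x); lra.
Qed.

Lemma value_lim_le n x : value_lim x <= value n x.
Proof. by case/andP: (range_inf x value_bdd n). Qed.

Lemma value_lim_bell x : value_lim x <= bell k value_lim x.
Proof.
apply: le_bell => _ [w xw|dl|E ns xE].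
- apply: le_trans (value_lim_le 1 x) _; apply: bell_le (Succeed _ _ xw) => //.
  exact: (value_bdd 0).
- apply: le_trans (value_lim_le 1 x) _; apply: bell_le (Deadlock _ _ dl) => //.
  exact: (value_bdd 0).
- apply: (Exp_inf value_bdd value_noninc) => n.
  apply: le_trans (value_lim_le n.+1 x) _; apply: bell_le => //.
    exact: value_bdd.
  exact: Step.
Qed.

Hypothesis U12 : forall n, bdd 2 (U n).
Hypothesis U0_bell : forall x, bell (fun=> 2) (U 0%N) x <= U 0%N x.
Hypothesis U_bell : forall n x, bell k (U n) x <= U n.+1 x.
Hypothesis yU : dominated (U 0%N) y.

Lemma U_succ n t p w : enabled t (Some (inr w)) -> k w <= U n (t, p).
Proof.
move=> tw; case: n => [|n].
  apply: le_trans (U0_bell _); apply: le_bell => _ [w' _|dl|E ns _].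
  - by case/andP: (k2 w).
  - by case: (dl (Some w)); exact/par_succ.
  - by case: (ns w); exact/par_succ.
apply: le_trans (U_bell _ _); apply: le_bell => _ [w' /par_succ tw'|dl|E ns _].
- by rewrite (T_tests.1 t w w').
- by case: (dl (Some w)); exact/par_succ.
- by case: (ns w); exact/par_succ.
Qed.

Lemma value_lim_simulated n t p D : simulated p D ->
  Exp D (fun p' => value_lim (t, p')) <= U n (t, p).
Proof.
elim: n t p D => [|n IH] t p D pD.
  have [_ _ yU0] := yU; apply: le_trans (yU0 t _ _ pD).
  apply: (@le_Exp _ _ _ _ _ 2) => [q|q|q _].
  - by have := y12 (t, q); lra.
  - by case/andP: (value_lim_bdd (t, q)).
  - exact: (value_lim_le 0).
apply: le_trans (U_bell _ _); apply: le_bell => z oz; rewrite -[z]addr0.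
have vb := value_lim_bell; have v2 := value_lim_bdd.
apply: (@simulated_option k value_lim (U n) k2 v2 (U12 n) vb IH _ value_lim (U n) 0 2 p D t z) => //.
- exact: U_succ.
- by move=> E _; rewrite addr0.
Qed.

Lemma value_lim_fs n Th : is_dist Gamma -> is_dist Delta -> fs_le Delta Gamma ->
  Exp (prodd Th Delta) value_lim <= Exp (prodd Th Gamma) (U n).
Proof.
move=> G1 D1 [D' [DD' GD']].
have DX : supp Delta `<=` XD by move=> s; exact: reachable_init.
rewrite (Exp_prodd _ _ _ value_lim_bdd)// (Exp_prodd _ _ _ (U12 n))//.
apply: (@le_Exp _ _ _ _ _ 2) => [t|t|t _].
- by apply: bdd_Exp => // q; exact: U12.
- by apply: Exp_ge0 => q; case/andP: (value_lim_bdd (t, q)).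
- apply: (@Exp_hyper_lift k value_lim (U n) k2 value_lim_bdd (U12 n)
    value_lim_bell (@value_lim_simulated n) (@U_succ n) _ _ _ _ DX DD') => //.
  + by move=> s; exact: reachable_init.
  + exact: hyper_supp DX DD'.
  + exact: (hyper_dist Delta_fin Delta_conv DX DD').
Qed.

End Values.

End FailureSimulation.

(** * Outcomes of deterministic systems *)

Section Weights.
Variables (R : realType) (S : choiceType).

Lemma le_Exp_weight (D D' : subdist R S) g c : bdd c g ->
  (forall s, D s <= D' s) -> Exp D g <= Exp D' g.
Proof.
move=> gc DD'; rewrite -lee_fin !(Exp_EFin _ gc).
by apply: le_esum => s _; rewrite lee_fin ler_wpM2r//; case/andP: (gc s).
Qed.

Lemma Exp_zerod (g : S -> R) : Exp (zerod R S) g = 0.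
Proof. by rewrite /Exp esum1// => s _; rewrite mul0r. Qed.

Lemma weight_bdd (D : subdist R S) : bdd 1 D.
Proof. by move=> s; exact: (bdd_weight (fun=> D) s s). Qed.

Variable D : nat -> subdist R S.
Hypothesis D_mono : forall n s, D n s <= D n.+1 s.

Let lim s := sup (range (fun n => D n s)).

Lemma weight_sup_le (g : S -> R) (K : R) : (forall s, 0 <= g s) ->
  (forall n, \esum_(s in [set: S]) (g s * D n s)%:E <= K%:E)%E ->
  (\esum_(s in [set: S]) (g s * lim s)%:E <= K%:E)%E.
Proof.
move=> g0 h.
have limE s : lim s = sup [set f s | f in range (fun n => D n : S -> R)].
  by rewrite /lim image_comp.
under eq_esum do rewrite limE.
apply: (esum_sup_chain (c := 1)) => //.
- by move=> _ [n _ <-]; exact: weight_bdd.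
- by exists (D 0%N), 0%N.
- move=> _ _ [m _ <-] [n _ <-].
  have H := @nondec_chain R S (fun n => D n) D_mono.
  by have [mn|/ltnW nm] := leqP m n; [left|right]; exact: H.
- by move=> _ [n _ <-].
Qed.

Definition sup_subdist : subdist R S.
Proof.
refine (@Subdist R S lim _ _).
- move=> s; have := range_sup s (fun n => weight_bdd (D n)) 0.
  by case/andP => + _; apply: le_trans; exact: weight_ge0.
- have := @weight_sup_le (fun=> 1) 1 (fun=> ler01).
  under eq_esum do rewrite mul1r; apply => n.
  by under eq_esum do rewrite mul1r; exact: weight_le1.
Defined.

Lemma sup_subdist_ge n s : D n s <= sup_subdist s.
Proof. by case/andP: (range_sup s (fun n => weight_bdd (D n)) n). Qed.

Lemma sup_subdist_le s K : (forall n, D n s <= K) -> sup_subdist s <= K.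
Proof.
by move=> h; apply: ge_sup; [exists (D 0%N s), 0%N|move=> _ [n _ <-]].
Qed.

Lemma Exp_sup_subdist g c K : bdd c g -> (forall n, Exp (D n) g <= K) ->
  Exp sup_subdist g <= K.
Proof.
move=> gc h; rewrite -lee_fin (Exp_EFin _ gc).
under eq_esum do rewrite mulrC.
apply: weight_sup_le => [s|n]; first by case/andP: (gc s).
under eq_esum do rewrite mulrC.
by rewrite -(Exp_EFin _ gc) lee_fin.
Qed.

End Weights.

Lemma reward_subdist (R : realType) (Om : choiceType) (h : Om -> R)
    (o : subdist R Om) : (forall w, -1 <= h w <= 1) ->
  reward h o = (Exp o (fun w => h w + 1) - Exp o (fun=> 1))%:E.
Proof.
move=> h1; rewrite /reward.
pose hp w := Num.max (h w) 0; pose hm w := Num.max (- h w) 0.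
have hp1 : bdd 1 hp.
  by move=> w; rewrite /hp le_max lexx orbT ge_max ler01 andbT; case/andP: (h1 w).
have hm1 : bdd 1 hm.
  by move=> w; rewrite /hm le_max lexx orbT ge_max ler01 andbT; have := h1 w; lra.
have -> : (\esum_(w in [set: Om]) (fun w => (h w * o w)%:E)^\+ w = (Exp o hp)%:E)%E.
  rewrite (Exp_EFin _ hp1); apply: eq_esum => w _.
  by rewrite funeposE -EFin_max mulrC maxr_pMr ?weight_ge0// mulr0.
have -> : (\esum_(w in [set: Om]) (fun w => (h w * o w)%:E)^\- w = (Exp o hm)%:E)%E.
  rewrite (Exp_EFin _ hm1); apply: eq_esum => w _.
  by rewrite funenegE -EFinN -EFin_max -mulNr mulrC maxr_pMr ?weight_ge0// mulr0.
rewrite -EFinB; congr EFin.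
have k2 : bdd 2 (fun w => h w + 1) by move=> w; have := h1 w; lra.
have : Exp o hp + Exp o (fun=> 1) = Exp o (fun w => h w + 1) + Exp o hm.
  rewrite -(ExpD _ hp1 (@bdd1 _ _)) -(ExpD _ k2 hm1); apply: eq_Exp => w _.
  rewrite /hp /hm; case: (leP (h w) 0) => hw.
    by rewrite max_l; lra.
  by rewrite max_r; lra.
lra.
Qed.

Section Valuation.
Variables (R : realType) (Om : choiceType) (Q : pLTS R Om).
Hypothesis Q_det : deterministic Q.
Hypothesis succ_uniq : forall (r : Q) w w',
  enabled r (Some w) -> enabled r (Some w') -> w = w'.
Hypothesis succ_step : forall (r : Q) w E r',
  enabled r (Some w) -> trans r None E -> supp E r' -> enabled r' (Some w).

Fixpoint outcome_n (n : nat) (r : Q) : subdist R Om :=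
  if n is n'.+1 then
    if pselect (exists w, enabled r (Some w)) is left e then pdist R (sval (cid e))
    else if pselect (enabled r None) is left e
         then bind (sval (cid e)) (outcome_n n')
         else zerod R Om
  else zerod R Om.

Lemma outcome_n_succ n r w : enabled r (Some w) -> outcome_n n.+1 r = pdist R w.
Proof.
move=> rw /=; case: pselect => [e|ne]; last by case: ne; exists w.
by rewrite (succ_uniq rw (svalP (cid e))).
Qed.

Lemma outcome_n_step n r E : (forall w, ~ enabled r (Some w)) ->
  trans r None E -> outcome_n n.+1 r = bind E (outcome_n n).
Proof.
move=> ns rE /=; case: pselect => [[w rw]|_]; first by case: (ns w).
case: pselect => [e|ne]; last by case: ne; exists E.
by rewrite (Q_det (svalP (cid e)) rE).
Qed.

Lemma outcome_n_dead n r : (forall a, ~ enabled r a) -> outcome_n n r = zerod R Om.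
Proof.
move=> nr; case: n => [//|n] /=.
case: pselect => [[w rw]|_]; first by case: (nr (Some w)).
by case: pselect => // e; case: (nr None).
Qed.

Variant state_spec (r : Q) : Prop :=
| Succeeding w of enabled r (Some w)
| Dead of (forall a, ~ enabled r a)
| Moving E of (forall w, ~ enabled r (Some w)) & trans r None E.

Lemma stateP r : state_spec r.
Proof.
have [[w rw]|nw] := pselect (exists w, enabled r (Some w)).
  exact: Succeeding rw.
have [[E rE]|nE] := pselect (enabled r None).
  by apply: Moving rE => w rw; apply: nw; exists w.
apply: Dead => -[w rw|//]; by apply: nw; exists w.
Qed.

Lemma outcome_n_mono n r w : outcome_n n r w <= outcome_n n.+1 r w.
Proof.
elim: n r w => [|n IH] r w; first exact: weight_ge0.
case: (stateP r) => [w' rw'|nr|E ns rE].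
- by rewrite !(outcome_n_succ _ rw').
- by rewrite !outcome_n_dead.
- rewrite !(outcome_n_step _ ns rE) /=.
  apply: (le_Exp (bdd_weight (outcome_n n.+1) w)) => [s|s _]; last exact: IH.
  exact: weight_ge0.
Qed.

Definition outcome (r : Q) : subdist R Om :=
  sup_subdist (D := fun n => outcome_n n r) (fun n => outcome_n_mono n r).

Lemma outcome_ge n r w : outcome_n n r w <= outcome r w.
Proof. exact: (sup_subdist_ge (D := fun n => outcome_n n r)). Qed.

Lemma outcome_le r w K : (forall n, outcome_n n r w <= K) -> outcome r w <= K.
Proof. exact: (sup_subdist_le (D := fun n => outcome_n n r)). Qed.

Lemma outcome_succ r w : enabled r (Some w) -> outcome r = pdist R w.
Proof.
move=> rw; apply: subdist_ext => w'; apply/eqP; rewrite eq_le; apply/andP; split.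
  apply: outcome_le => -[|n]; first exact: weight_ge0.
  by rewrite (outcome_n_succ _ rw).
by rewrite -(outcome_n_succ 0 rw); exact: outcome_ge.
Qed.

Lemma outcome_dead r : (forall a, ~ enabled r a) -> outcome r = zerod R Om.
Proof.
move=> nr; apply: subdist_ext => w; apply/eqP; rewrite eq_le; apply/andP; split.
  by apply: outcome_le => n; rewrite outcome_n_dead.
exact: weight_ge0.
Qed.

Lemma outcome_step r E : (forall w, ~ enabled r (Some w)) -> trans r None E ->
  outcome r = bind E outcome.
Proof.
move=> ns rE; apply: subdist_ext => w; apply/eqP; rewrite eq_le; apply/andP; split.
  apply: outcome_le => -[|n]; first exact: weight_ge0.
  rewrite (outcome_n_step _ ns rE) /=.
  apply: (le_Exp (bdd_weight outcome w)) => s; first exact: weight_ge0.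
  by move=> _; exact: outcome_ge.
apply: (@Exp_sup _ _ E (fun n r => outcome_n n r w) 1).
- by move=> n; exact: bdd_weight.
- by move=> n s; exact: outcome_n_mono.
- move=> n; have := outcome_ge n.+1 r w.
  by rewrite (outcome_n_step _ ns rE).
Qed.

Lemma Exp_outcome_ge n r g c : bdd c g -> Exp (outcome_n n r) g <= Exp (outcome r) g.
Proof. by move=> gc; apply: (le_Exp_weight gc) => w; exact: outcome_ge. Qed.

Lemma Exp_outcome_le r g c K : bdd c g ->
  (forall n, Exp (outcome_n n r) g <= K) -> Exp (outcome r) g <= K.
Proof. exact: (Exp_sup_subdist (D := fun n => outcome_n n r)). Qed.

Lemma outcome_valuation : is_valuation (fun r w => outcome r w).
Proof.
split.
- by move=> r w; exact: weight_bdd.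
- apply/funext => r; apply/funext => w; rewrite /val_op.
  case: pselect => [rw|nrw]; first by rewrite (outcome_succ rw) /= eqxx.
  case: (stateP r) => [w' rw'|nr|E ns rE].
  + have ww' : pdist R w' w = 0.
      by rewrite /=; case: eqP => // ww; case: nrw; rewrite ww.
    rewrite (outcome_succ rw') ww'; case: pselect => // e.
    rewrite -[RHS](mul0r (fine (mass (sval (cid e))))) -Exp_cst//; apply: eq_Exp => s.
    by move=> /(succ_step rw' (svalP (cid e)))/outcome_succ ->.
  + by rewrite outcome_dead//; case: pselect => // e; case: (nr None).
  + case: pselect => [e|ne]; last by case: ne; exists E.
    by rewrite (Q_det (svalP (cid e)) rE) (outcome_step ns rE).
- move=> W W1 WE r w; apply: outcome_le => n.
  elim: n r w => [|n IH] r w; first by case/andP: (W1 r w).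
  case: (stateP r) => [w' rw'|nr|E ns rE].
  + rewrite (outcome_n_succ _ rw') /=.
    case: eqP => [->|_]; last by case/andP: (W1 r w).
    by rewrite -WE /val_op; case: pselect.
  + by rewrite outcome_n_dead//; case/andP: (W1 r w).
  + rewrite (outcome_n_step _ ns rE) -WE /val_op.
    case: pselect => /= [rw|_]; first by case: (ns w).
    case: pselect => [e|ne]; last by case: ne; exists E.
    rewrite (Q_det (svalP (cid e)) rE) /=.
    apply: (@le_Exp _ _ _ _ _ 1) => [s|s|s _]; [exact: W1|exact: weight_ge0|exact: IH].
Qed.

Lemma valuation_unique (V : Q -> Om -> R) : is_valuation V ->
  V = fun r w => outcome r w.
Proof.
move=> [V1 VE Vmin]; have [O1 OE Omin] := outcome_valuation.
apply/funext => r; apply/funext => w; apply/eqP; rewrite eq_le.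
by apply/andP; split; [exact: (Vmin _ O1 OE)|exact: (Omin _ V1 VE)].
Qed.

End Valuation.

Section Resolution.
Variables (R : realType) (Act : Type) (Om : choiceType).
Variables (T : pLTS R (Act + Om)) (P : pLTS R Act).
Hypothesis T_tests : is_test_pLTS T.
Local Notation C := (par T P).
Variables (Q : pLTS R Om) (f : Q -> C).
Hypothesis Q_det : deterministic Q.
Hypothesis f_step : forall r a E, trans r a E -> trans (f r) a (push f E).
Hypothesis f_enabled : forall r a, enabled (f r) a -> enabled r a.

Lemma enabled_res r a : enabled r a <-> enabled (f r) a.
Proof.
by split=> [[E rE]|]; [exists (push f E); exact: f_step|exact: f_enabled].
Qed.

Lemma res_succ_uniq (r : Q) w w' :
  enabled r (Some w) -> enabled r (Some w') -> w = w'.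
Proof. move=> /enabled_res rw /enabled_res; exact: par_succ_uniq T_tests _ _ _ rw. Qed.

Lemma res_succ_step (r : Q) w E r' :
  enabled r (Some w) -> trans r None E -> supp E r' -> enabled r' (Some w).
Proof.
move=> /enabled_res rw /f_step rE Er'; apply/enabled_res.
exact: (par_succ_step T_tests rw rE (supp_push_in f Er')).
Qed.

Definition res_outcome : Q -> subdist R Om := outcome Q_det res_succ_uniq.

Lemma outcome_res (Lam : subdist R Q) (V : Q -> Om -> R) : is_valuation V ->
  (fun w => Exp Lam (fun r => V r w)) = bind Lam res_outcome.
Proof. by move=> /(valuation_unique Q_det res_succ_uniq res_succ_step) ->. Qed.

Section LowerBound.
Variable k : Om -> R.
Hypothesis k2 : bdd 2 k.

(* [payoff n r] is the value of [r], shifted by 1, when successes are rewarded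
   according to [k] for [n] steps and with the maximal reward 2 afterwards. *)
Fixpoint payoff (n : nat) (r : Q) : R :=
  if n is n'.+1 then
    if pselect (exists w, enabled r (Some w)) is left e then k (sval (cid e))
    else if pselect (enabled r None) is left e
         then Exp (sval (cid e)) (payoff n')
         else 1
  else 1 + Exp (res_outcome r) (fun=> 1).

Lemma payoff_succ n r w : enabled r (Some w) -> payoff n.+1 r = k w.
Proof.
move=> rw /=; case: pselect => [e|ne]; last by case: ne; exists w.
by rewrite (res_succ_uniq rw (svalP (cid e))).
Qed.

Lemma payoff_step n r E : (forall w, ~ enabled r (Some w)) ->
  trans r None E -> payoff n.+1 r = Exp E (payoff n).
Proof.
move=> ns rE /=; case: pselect => [[w rw]|_]; first by case: (ns w).
case: pselect => [e|ne]; last by case: ne; exists E.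
by rewrite (Q_det (svalP (cid e)) rE).
Qed.

Lemma payoff_dead n r : (forall a, ~ enabled r a) -> payoff n.+1 r = 1.
Proof.
move=> nr /=; case: pselect => [[w rw]|_]; first by case: (nr (Some w)).
by case: pselect => // e; case: (nr None).
Qed.

Lemma payoff0_12 r : 1 <= payoff 0 r <= 2.
Proof.
have : 0 <= Exp (res_outcome r) (fun=> 1) <= 1 by apply: bdd_Exp => //; exact: bdd1.
by rewrite /=; lra.
Qed.

Lemma payoff_bdd n : bdd 2 (payoff n).
Proof.
elim: n => [|n IH] r; first by have := payoff0_12 r; lra.
case: (stateP r) => [w rw|nr|E ns rE].
- by rewrite (payoff_succ _ rw); exact: k2.
- by rewrite payoff_dead//; lra.
- by rewrite (payoff_step _ ns rE); exact: bdd_Exp.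
Qed.

Lemma bdd_Exp_outcome (O : Q -> subdist R Om) (g : Om -> R) c : 0 <= c -> bdd c g ->
  bdd c (fun r => Exp (O r) g).
Proof. by move=> c0 gc r; exact: bdd_Exp. Qed.

Lemma Exp_payoff_outcome n (E : subdist R Q) : is_dist E ->
  (forall r, payoff n r + 2 * Exp (outcome_n n r) (fun=> 1) =
     1 + Exp (res_outcome r) (fun=> 1) + Exp (outcome_n n r) k) ->
  Exp E (payoff n) + 2 * Exp E (fun r => Exp (outcome_n n r) (fun=> 1)) =
  1 + Exp E (fun r => Exp (res_outcome r) (fun=> 1)) +
  Exp E (fun r => Exp (outcome_n n r) k).
Proof.
move=> E1 h.
have b1 := bdd_Exp_outcome (outcome_n n) (@ler01 R) (@bdd1 _ _).
have b1' := bdd_Exp_outcome res_outcome (@ler01 R) (@bdd1 _ _).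
have bk := bdd_Exp_outcome (outcome_n n) (@ler0n R 2) k2.
have b2 : bdd 2 (fun r : Q => 2 * Exp (outcome_n n r) (fun=> 1)).
  by move=> r; have := b1 r; rewrite /=; lra.
have b3 : bdd 2 (fun r : Q => 1 + Exp (res_outcome r) (fun=> 1)).
  by move=> r; have := b1' r; rewrite /=; lra.
rewrite -(ExpZ E (ler0n R 2) (fun r => proj1 (andP (b1 r)))).
rewrite -(ExpD E (payoff_bdd n) b2) -[X in X + _ + _](Exp_dist E1 (@ler01 R)).
rewrite -(ExpD E (@bdd1 _ _) b1') -(ExpD E b3 bk).
by apply: eq_Exp => r _; exact: h.
Qed.

Lemma payoff_outcome n r : payoff n r + 2 * Exp (outcome_n n r) (fun=> 1) =
  1 + Exp (res_outcome r) (fun=> 1) + Exp (outcome_n n r) k.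
Proof.
have k0 w : 0 <= k w by case/andP: (k2 w).
elim: n r => [|n IH] r; first by rewrite /= !Exp_zerod; lra.
case: (stateP r) => [w rw|nr|E ns rE].
- rewrite (payoff_succ _ rw) (outcome_n_succ res_succ_uniq _ rw).
  by rewrite /res_outcome (outcome_succ _ _ rw) !Exp_pdist//; lra.
- by rewrite payoff_dead// /res_outcome outcome_dead// outcome_n_dead// !Exp_zerod; lra.
- rewrite (payoff_step _ ns rE) (outcome_n_step Q_det _ ns rE).
  rewrite /res_outcome (outcome_step _ _ ns rE).
  rewrite !(Exp_bind _ _ (@ler01 R) (@bdd1 _ _)) (Exp_bind _ _ (ler0n R 2) k2).
  exact: Exp_payoff_outcome (trans_dist rE) IH.
Qed.

Definition best_payoff n (x : C) : R :=
  inf [set z | z = 2 \/ exists2 r, f r = x & z = payoff n r].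

Lemma best_payoff_le n r : best_payoff n (f r) <= payoff n r.
Proof.
apply: ge_inf; last by right; exists r.
by exists 0 => _ [->|[s _ ->]]; [lra|case/andP: (payoff_bdd n s)].
Qed.

Lemma le_best_payoff n x a : a <= 2 -> (forall r, f r = x -> a <= payoff n r) ->
  a <= best_payoff n x.
Proof.
move=> a2 h; apply: lb_le_inf; first by exists 2; left.
by move=> _ [->//|[r /h + ->]].
Qed.

Lemma best_payoff_bdd n : bdd 2 (best_payoff n).
Proof.
move=> x; apply/andP; split.
  by apply: le_best_payoff => [//|r _]; case/andP: (payoff_bdd n r).
apply: ge_inf; last by left.
by exists 0 => _ [->|[s _ ->]]; [lra|case/andP: (payoff_bdd n s)].
Qed.

Lemma best_payoff0_12 x : 1 <= best_payoff 0 x <= 2.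
Proof.
apply/andP; split; last by case/andP: (best_payoff_bdd 0 x).
by apply: le_best_payoff => [|r _]; [lra|case/andP: (payoff0_12 r)].
Qed.

Lemma Exp_best_payoff n (Lam : subdist R Q) :
  Exp (push f Lam) (best_payoff n) <= Exp Lam (payoff n).
Proof.
rewrite (Exp_push _ _ (ler0n R 2) (best_payoff_bdd n)).
apply: (le_Exp (payoff_bdd n)) => [r|r _]; last exact: best_payoff_le.
by case/andP: (best_payoff_bdd n (f r)).
Qed.

Lemma best_payoff_bell0 x : bell (fun=> 2) (best_payoff 0) x <= best_payoff 0 x.
Proof.
have b2 := best_payoff_bdd 0.
apply: le_best_payoff => [|r fr].
  by case/andP: (bell_bdd (@two_bdd R Om) b2 x).
case: (stateP r) => [w rw|nr|E ns rE].
- rewrite /= /res_outcome (outcome_succ _ _ rw) Exp_pdist//.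
  apply: (bell_le (@two_bdd R Om) b2).
  rewrite (_ : 1 + 1 = 2)//; apply: (@Succeed _ _ _ (fun=> 2) _ _ w).
  by rewrite -fr; exact/enabled_res.
- rewrite /= /res_outcome outcome_dead// Exp_zerod addr0.
  apply: (bell_le (@two_bdd R Om) b2); apply: Deadlock => a.
  by rewrite -fr => /enabled_res; exact: nr.
- apply: (@le_trans _ _ (Exp (push f E) (best_payoff 0))).
    apply: (bell_le (@two_bdd R Om) b2); apply: Step; last by rewrite -fr; exact: f_step.
    by move=> w; rewrite -fr => /enabled_res; exact: ns.
  apply: le_trans (Exp_best_payoff _ _) _.
  rewrite /= /res_outcome (outcome_step _ _ ns rE).
  rewrite (Exp_bind _ _ (@ler01 R) (@bdd1 _ _)).
  rewrite (ExpD E (@bdd1 _ _) (bdd_Exp_outcome _ (@ler01 R) (@bdd1 _ _))).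
  by rewrite Exp_dist//; exact: trans_dist rE.
Qed.

Lemma best_payoff_bell n x : bell k (best_payoff n) x <= best_payoff n.+1 x.
Proof.
have b2 := best_payoff_bdd n.
apply: le_best_payoff => [|r fr]; first by case/andP: (bell_bdd k2 b2 x).
case: (stateP r) => [w rw|nr|E ns rE].
- rewrite (payoff_succ _ rw); apply: (bell_le k2 b2); apply: Succeed.
  by rewrite -fr; exact/enabled_res.
- rewrite payoff_dead//; apply: (bell_le k2 b2); apply: Deadlock => a.
  by rewrite -fr => /enabled_res; exact: nr.
- apply: (@le_trans _ _ (Exp (push f E) (best_payoff n))).
    apply: (bell_le k2 b2); apply: Step; last by rewrite -fr; exact: f_step.
    by move=> w; rewrite -fr => /enabled_res; exact: ns.
  by rewrite (payoff_step _ ns rE); exact: Exp_best_payoff.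
Qed.

Lemma payoff_lim (Lam : subdist R Q) a : is_dist Lam ->
  (forall n, a <= Exp (push f Lam) (best_payoff n)) ->
  a - 1 <= Exp (bind Lam res_outcome) k - Exp (bind Lam res_outcome) (fun=> 1).
Proof.
move=> L1 h.
rewrite (Exp_bind _ _ (@ler01 R) (@bdd1 _ _)) (Exp_bind _ _ (ler0n R 2) k2).
set M := Exp Lam (fun r => Exp (res_outcome r) (fun=> 1)).
set K := Exp Lam (fun r => Exp (res_outcome r) k).
have mono n (r : Q) : Exp (outcome_n n r) (fun=> 1) <= Exp (outcome_n n.+1 r) (fun=> 1).
  by apply: (le_Exp_weight (@bdd1 _ _)) => w; exact: (outcome_n_mono Q_det res_succ_uniq).
have b1 n := bdd_Exp_outcome (outcome_n n) (@ler01 R) (@bdd1 R Om).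
suff : M <= (1 + M + K - a) / 2 by lra.
apply: (@le_trans _ _ (Exp Lam (fun r => sup (range (fun n => Exp (outcome_n n r) (fun=> 1)))))).
  apply: (@le_Exp _ _ _ _ _ 1) => [r|r|r _].
  - have := range_sup r b1 0; have := b1 0%N r; rewrite /=; lra.
  - exact: Exp_ge0.
  - apply: (@Exp_outcome_le _ _ _ Q_det res_succ_uniq r _ 1 _ (@bdd1 _ _)) => n.
    by case/andP: (range_sup r b1 n).
apply: (Exp_sup b1 mono) => n.
have := Exp_payoff_outcome L1 (payoff_outcome n).
have : Exp Lam (fun r => Exp (outcome_n n r) k) <= K.
  apply: (le_Exp (bdd_Exp_outcome res_outcome (ler0n R 2) k2)) => [r|r _].
    by apply: Exp_ge0 => w; case/andP: (k2 w).
  exact: Exp_outcome_ge k2.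
have := le_trans (h n) (Exp_best_payoff n Lam).
by rewrite /M; lra.
Qed.

End LowerBound.

End Resolution.

(** * Epsilon-optimal schedulers *)

Section Policy.
Variables (R : realType) (Act : Type) (Om : choiceType).
Variables (T : pLTS R (Act + Om)) (P : pLTS R Act).
Hypothesis T_tests : is_test_pLTS T.
Local Notation C := (par T P).
Variable policy : nat -> C -> option Om -> subdist R C.
Hypothesis policy_trans : forall j x a, enabled x a -> trans x a (policy j x a).

(* States are stamped with the time, so that the time-dependent policy becomes a
   deterministic system. *)
Definition play_trans (q : nat * C) (a : option Om) (E : subdist R (nat * C)%type) :=
  enabled q.2 a /\ E = push (fun x => (q.1.+1, x)) (policy q.1 q.2 a).

Lemma play_trans_dist q a E : play_trans q a E -> is_dist E.
Proof.
move=> [qa ->]; rewrite push_bind; apply: is_dist_bind.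
  exact: trans_dist (policy_trans q.1 qa).
by move=> s _; exact: is_dist_pdist.
Qed.

Definition play : pLTS R Om := PLTS play_trans_dist.

Lemma play_det : deterministic play.
Proof. by move=> q a D E [_ ->] [_ ->]. Qed.

Lemma play_step (q : play) a E : trans q a E -> trans (q.2 : C) a (push snd E).
Proof.
move=> [qa ->]; rewrite push_comp_id//; exact: policy_trans.
Qed.

Lemma play_enabled (q : play) a : enabled (q.2 : C) a -> enabled q a.
Proof. by move=> qa; eexists; split. Qed.

Lemma play_outcome (Th : subdist R T) (D : subdist R P) :
  outcomes Th D (bind (push (fun x => (0%N, x) : play) (prodd Th D))
    (res_outcome T_tests play_det play_step play_enabled)).
Proof.
exists play, (push (fun x => (0%N, x) : play) (prodd Th D)), snd,
  (fun r w => res_outcome T_tests play_det play_step play_enabled r w); split.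
- split; [exact: play_det|exact: push_comp_id|exact: play_step|exact: play_enabled].
- exact: (outcome_valuation play_det _ (res_succ_step T_tests play_step play_enabled)).
- by [].
Qed.

Local Notation O := (res_outcome T_tests play_det play_step play_enabled).

Lemma le_Exp_affine (S : choiceType) (E : subdist R S) (g1 g2 p : S -> R) e :
  is_dist E -> 0 <= e -> bdd 2 g1 -> bdd 1 g2 -> bdd 2 p ->
  (forall s, 1 + g1 s <= p s + e + g2 s) ->
  1 + Exp E g1 <= Exp E p + e + Exp E g2.
Proof.
move=> E1 e0 b1 b2 bp h.
have be : bdd e (fun=> e : R) (S := S) by move=> s; rewrite e0 lexx.
have bpe : bdd (2 + e) (fun s => p s + e) by move=> s; have := bp s; lra.
rewrite -[X in X + _ <= _](Exp_dist E1 (@ler01 R)) -[X in _ + X + _](Exp_dist E1 e0).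
rewrite -(ExpD E (@bdd1 _ _) b1) -(ExpD E bp be) -(ExpD E bpe b2).
apply: (@le_Exp _ _ _ _ _ (3 + e)) => // s.
  by have := bpe s; have := b2 s; lra.
by have := b1 s; lra.
Qed.

Variables (n : nat) (k : Om -> R) (phi : nat -> C -> R) (eps : nat -> R).
Hypothesis k2 : bdd 2 k.
Hypothesis phi2 : forall j, bdd 2 (phi j).
Hypothesis eps0 : forall j, 0 <= eps j.
Hypothesis phi_step : forall j x, (forall w, ~ enabled x (Some w)) ->
  enabled x None -> Exp (policy j x None) (phi j.+1) + eps j.+1 <= phi j x + eps j.
Hypothesis phi_dead : forall j x, (forall a, ~ enabled x a) -> 1 <= phi j x.
Hypothesis phi_succ : forall j x w, (j < n)%N -> enabled x (Some w) -> k w <= phi j x.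
Hypothesis phi_tail : forall j x, (n <= j)%N -> 1 <= phi j x.
Hypothesis phi_tail_succ : forall j x w,
  (n <= j)%N -> enabled x (Some w) -> 2 <= phi j x.

Let enabledE (q : play) a : enabled q a <-> enabled (q.2 : C) a.
Proof. exact: enabled_res play_step play_enabled q a. Qed.

Let succ_uniq := res_succ_uniq T_tests play_step play_enabled.

Lemma play_moveE (q : play) E : trans q None E ->
  E = push (fun x => (q.1.+1, x)) (policy q.1 q.2 None).
Proof. by case. Qed.

Lemma play_tail_n i j x : (n <= j)%N ->
  1 + Exp (outcome_n i ((j, x) : play)) (fun=> 1) <= phi j x + eps j.
Proof.
elim: i j x => [|i IH] j x nj.
  by rewrite Exp_zerod; have := phi_tail x nj; have := eps0 j; lra.
case: (stateP ((j, x) : play)) => [w rw|nr|E ns rE].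
- rewrite (outcome_n_succ succ_uniq _ rw) Exp_pdist//.
  by move/enabledE: rw => /(phi_tail_succ nj); have := eps0 j; lra.
- by rewrite outcome_n_dead// Exp_zerod; have := phi_tail x nj; have := eps0 j; lra.
- rewrite (outcome_n_step play_det _ ns rE) (play_moveE rE).
  have xt : enabled x None by apply/(enabledE (j, x)); exists E.
  have xns w : ~ enabled x (Some w) by move/(enabledE (j, x)); exact: ns.
  rewrite (Exp_bind _ _ (@ler01 R) (@bdd1 _ _)).
  rewrite (Exp_push _ _ (@ler01 R) (bdd_Exp_outcome _ (@ler01 R) (@bdd1 _ _))).
  apply: le_trans (phi_step j xns xt).
  have := @le_Exp_affine _ (policy j x None)
    (fun x' => Exp (outcome_n i ((j.+1, x') : play)) (fun=> 1)) (fun=> 0) (phi j.+1)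
    (eps j.+1).
  rewrite Exp_cst// mul0r addr0; apply => //.
  + exact: trans_dist (policy_trans j xt).
  + move=> x'; have : 0 <= Exp (outcome_n i ((j.+1, x') : play)) (fun=> 1) <= 1.
      by apply: bdd_Exp => //; exact: bdd1.
    by lra.
  + by move=> x'; lra.
  + by move=> x'; rewrite addr0; exact/IH/leqW.
Qed.

Lemma play_tail j x : (n <= j)%N -> 1 + Exp (O (j, x)) (fun=> 1) <= phi j x + eps j.
Proof.
move=> nj; suff : Exp (O (j, x)) (fun=> 1) <= phi j x + eps j - 1 by lra.
apply: (@Exp_outcome_le _ _ _ play_det succ_uniq (j, x) _ 1 _ (@bdd1 _ _)) => i.
by have := play_tail_n i x nj; lra.
Qed.

Lemma play_head d j x : (j + d)%N = n ->
  1 + Exp (O (j, x)) k <= phi j x + eps j + Exp (O (j, x)) (fun=> 1).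
Proof.
have k0 w : 0 <= k w by case/andP: (k2 w).
elim: d j x => [|d IH] j x jd.
  have jn : (n <= j)%N by rewrite -jd addn0.
  have := play_tail x jn; suff : Exp (O (j, x)) k <= 2 * Exp (O (j, x)) (fun=> 1) by lra.
  rewrite -(ExpZ _ (ler0n R 2))//; apply: (@le_Exp _ _ _ _ _ 2) => [w|//|w _].
    by rewrite mulr1; lra.
  by rewrite mulr1; case/andP: (k2 w).
have jn : (j < n)%N by rewrite -jd addnS ltnS leq_addr.
case: (stateP ((j, x) : play)) => [w rw|nr|E ns rE].
- rewrite /res_outcome (outcome_succ _ _ rw) !Exp_pdist//.
  by move/enabledE: rw => /(phi_succ jn); have := eps0 j; lra.
- rewrite /res_outcome outcome_dead// !Exp_zerod.
  have : 1 <= phi j x by apply: phi_dead => a /(enabledE (j, x)); exact: nr.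
  by have := eps0 j; lra.
- have xt : enabled x None by apply/(enabledE (j, x)); exists E.
  have xns w : ~ enabled x (Some w) by move/(enabledE (j, x)); exact: ns.
  rewrite /res_outcome (outcome_step _ _ ns rE) (play_moveE rE) -/O.
  rewrite (Exp_bind _ _ (ler0n R 2) k2) (Exp_bind _ _ (@ler01 R) (@bdd1 _ _)).
  rewrite (Exp_push _ _ (ler0n R 2) (bdd_Exp_outcome _ (ler0n R 2) k2)).
  rewrite (Exp_push _ _ (@ler01 R) (bdd_Exp_outcome _ (@ler01 R) (@bdd1 _ _))).
  apply: le_trans (lerD (phi_step j xns xt) (lexx _)).
  apply: le_Exp_affine => //.
  + exact: trans_dist (policy_trans j xt).
  + by move=> x'; exact: bdd_Exp.
  + by move=> x'; apply: bdd_Exp => //; exact: bdd1.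
  + by move=> x'; apply: IH; rewrite addSnnS.
Qed.

Lemma play_reward (D : subdist R C) o : is_dist D ->
  o = bind (push (fun x => (0%N, x) : play) D) O ->
  Exp o k - Exp o (fun=> 1) <= Exp D (phi 0%N) + eps 0%N - 1.
Proof.
move=> D1 ->.
rewrite (Exp_bind _ _ (ler0n R 2) k2) (Exp_bind _ _ (@ler01 R) (@bdd1 _ _)).
rewrite (Exp_push _ _ (ler0n R 2) (bdd_Exp_outcome _ (ler0n R 2) k2)).
rewrite (Exp_push _ _ (@ler01 R) (bdd_Exp_outcome _ (@ler01 R) (@bdd1 _ _))).
have := @le_Exp_affine _ D (fun x => Exp (O (0%N, x)) k)
  (fun x => Exp (O (0%N, x)) (fun=> 1)) (phi 0%N) (eps 0%N) D1 (eps0 0).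
move=> H; suff : 1 + Exp D (fun x => Exp (O (0%N, x)) k) <=
  Exp D (phi 0%N) + eps 0%N + Exp D (fun x => Exp (O (0%N, x)) (fun=> 1)).
  by rewrite /comp; lra.
apply: H => //.
- by move=> x'; exact: bdd_Exp.
- by move=> x'; apply: bdd_Exp => //; exact: bdd1.
- by move=> x'; exact: (@play_head n).
Qed.

End Policy.

Section UpperBound.
Variables (R : realType) (Act : Type) (Om : choiceType).
Variables (T : pLTS R (Act + Om)) (P : pLTS R Act).
Hypothesis T_tests : is_test_pLTS T.
Local Notation C := (par T P).

Lemma bell_approx (k : Om -> R) (y : C -> R) (x : C) d : bdd 2 k -> bdd 2 y ->
  0 < d -> (forall w, ~ enabled x (Some w)) -> enabled x None ->
  exists2 E, trans x None E & Exp E y <= bell k y x + d.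
Proof.
move=> k2 y2 d0 ns xt.
have [|z [w xw|dl|E _ xE] /ltW zle] := @inf_adherent R (option_value k y x) d d0.
- split; first exact: option_value_ex.
  by exists 0 => z /(option_value_bdd k2 y2)/andP[].
- by case: (ns w).
- by case: (dl None).
- by exists E.
Qed.

Variables (k : Om -> R) (y : C -> R).
Hypothesis k2 : bdd 2 k.
Hypothesis y12 : forall x, 1 <= y x <= 2.
Hypothesis y_fix : forall x, bell (fun=> 2) y x = y x.

Lemma value_approx (n : nat) (e : R) (Th : subdist R T) (D : subdist R P) :
  0 < e -> is_dist Th -> is_dist D ->
  exists2 o : subdist R Om, outcomes Th D o &
    Exp o k - Exp o (fun=> 1) <= Exp (prodd Th D) (value k y n) + e - 1.
Proof.
move=> e0 Th1 D1.
have y2 : bdd 2 y by move=> x; have := y12 x; lra.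
have v2 := value_bdd k2 y12.
pose phi j := value k y (n - j).
pose eps j : R := e / 2 ^+ j.
have epsS j : eps j - eps j.+1 = eps j.+1.
  by rewrite /eps exprS invfM mulrCA; lra.
have eps_gt0 j : 0 < eps j by rewrite divr_gt0// exprn_gt0.
have phiE j : exists k', [/\ bdd 2 k', forall x, phi j x = bell k' (phi j.+1) x &
    if (j < n)%N then k' = k else k' = fun=> 2].
  rewrite /phi; have [jn|nj] := ltnP j n.
    by exists k; split=> // x; rewrite -[(n - j)%N]prednK ?subn_gt0// subnS.
  exists (fun=> 2); split=> [|x|//]; first exact: two_bdd.
  by rewrite (eqP nj) (eqP (leqW nj)) /= y_fix.
have /choice[sg sgP] : forall jxa : nat * C * option Om, exists E,
    let: (j, x, a) := jxa in enabled x a -> trans x a E /\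
      (a = None -> (forall w, ~ enabled x (Some w)) ->
       Exp E (phi j.+1) + eps j.+1 <= phi j x + eps j).
  move=> [[j x] a]; have [xa|] := pselect (enabled x a); last first.
    by exists (pdist R x).
  have [k' [k'2 phiEj _]] := phiE j.
  have [[aN ns]|h] := pselect (a = None /\ forall w, ~ enabled x (Some w)).
    rewrite aN in xa *.
    have [E xE EE] := bell_approx k'2 (v2 (n - j.+1)%N) (eps_gt0 j.+1) ns xa.
    exists E => _; split=> // _ _; rewrite phiEj.
    by have := epsS j; rewrite -/(phi j.+1) in EE; lra.
  case: xa => E xE; exists E => _; split=> // aN ns; case: h; split => //.
pose policy j x a := sg (j, x, a).
have policyP j x a : enabled x a -> trans x a (policy j x a).
  by move=> /(sgP (j, x, a))[].
exists (bind (push (fun x => (0%N, x) : play policyP) (prodd Th D))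
  (res_outcome T_tests (@play_det _ _ _ _ _ _ policyP)
    (@play_step _ _ _ _ _ _ policyP) (@play_enabled _ _ _ _ _ _ policyP))).
  exact: play_outcome.
have -> : Exp (prodd Th D) (value k y n) + e - 1 =
    Exp (prodd Th D) (phi 0%N) + eps 0%N - 1.
  by rewrite /phi /eps subn0 expr0 divr1.
have phi_bell j x z k' : bdd 2 k' -> phi j x = bell k' (phi j.+1) x ->
    (forall z', option_value k' (phi j.+1) x z' -> z <= z') -> z <= phi j x.
  by move=> k'2 ->; exact: le_bell.
apply: (@play_reward _ _ _ _ _ T_tests _ policyP n k phi eps k2) => //.
- by move=> j; exact: v2.
- by move=> j; exact: ltW.
- by move=> j x ns xt; exact: (sgP (j, x, None) xt).2.
- move=> j x dl; have [k' [k'2 phiEj _]] := phiE j.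
  apply: (phi_bell j x _ k' k'2 (phiEj x)) => _ [w xw|//|E _ xE].
    by case: (dl (Some w)).
  by case: (dl None); exists E.
- move=> j x w jn xw; have [k' [k'2 phiEj]] := phiE j; rewrite jn => kk.
  rewrite kk in k'2 phiEj.
  apply: (phi_bell j x _ k k'2 (phiEj x)) => _ [w' xw'|dl|E ns _].
  + by rewrite (par_succ_uniq T_tests xw xw').
  + by case: (dl (Some w)).
  + by case: (ns w).
- by move=> j x nj; rewrite /phi (eqP nj); case/andP: (y12 x).
- move=> j x w nj xw; rewrite /phi (eqP nj) /= -y_fix.
  apply: le_bell => _ [//|dl|E ns _].
  + by case: (dl (Some w)).
  + by case: (ns w).
- exact: is_dist_prodd.
Qed.

End UpperBound.

Theorem theorem28 (R : realType) (Act : Type) (Om : countType)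
    (Om_infinite : infinite_set [set: Om])
    (P : pLTS R Act) (T : pLTS R (Act + Om)) (T_tests : is_test_pLTS T)
    (Delta Gamma : subdist R P)
    (Delta_dist : is_dist Delta) (Gamma_dist : is_dist Gamma)
    (Delta_fin : finitary Delta) (Gamma_fin : finitary Gamma)
    (Delta_conv : convergent Delta) (Gamma_conv : convergent Gamma) :
  fs_le Delta Gamma -> rrmust_le T Delta Gamma.
Proof.
move=> FS Th h Th1 h1.
pose k w := h w + 1.
have k2 : bdd 2 k by move=> w; have := h1 w; rewrite /k; lra.
apply: le_ereal_inf_tmp => _ [o [Q [Lam [f [V [[Q_det fLam f_step f_en] VV ->]]]]] <-].
pose U := best_payoff T_tests Q_det f_step f_en k.
have U2 n : bdd 2 (U n) by exact: best_payoff_bdd.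
have U_bell0 x : bell (fun=> 2) (U 0%N) x <= U 0%N x by exact: best_payoff_bell0.
have U_bell n x : bell k (U n) x <= U n.+1 x by exact: best_payoff_bell.
have [y [dy y_fix]] := dominated_fixpoint Delta_fin Gamma_fin
  Delta_conv Gamma_conv (best_payoff0_12 T_tests Q_det f_step f_en k2) U_bell0.
have [y12 _ _] := dy.
set c := Exp (prodd Th Delta) (value_lim k y).
have Lam1 : is_dist Lam.
  apply/dist1; have /dist1 m1 := is_dist_prodd Th1 Gamma_dist.
  by rewrite -[RHS]m1 -fLam (Exp_push _ _ (@ler01 R) (@bdd1 _ _)).
apply: (@le_trans _ _ (c - 1)%:E); last first.
  rewrite (outcome_res T_tests Q_det f_step f_en _ VV) reward_subdist// lee_fin.
  apply: (payoff_lim k2 Lam1) => n; rewrite fLam.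
  exact: (value_lim_fs T_tests Delta_fin Delta_conv k2
    y12 y_fix U2 U_bell0 U_bell dy n _ Gamma_dist Delta_dist FS).
apply/lee_addgt0Pr => e e0.
have [n vn] : exists n, Exp (prodd Th Delta) (value k y n) <= c + e / 2.
  apply: contrapT => hn.
  have : c + e / 2 <= c.
    apply: (Exp_inf (value_bdd k2 y12) (value_noninc k2 y12 y_fix)) => n.
    by rewrite leNgt; apply/negP => /ltW le; apply: hn; exists n.
  lra.
have e2 : 0 < e / 2 by lra.
have [o' oo' ole] := value_approx T_tests k2 y12 y_fix n e2 Th1 Delta_dist.
apply: ge_ereal_inf; exists (reward h o'); first by exists o'.
by rewrite reward_subdist// -EFinD lee_fin; move: ole; rewrite -/k; lra.
Qed.
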